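(* Let $\mathcal A=\{a_1,\ldots,a_n\}\subset\mathbb N^m$ be a list of nonzero vectors such that $I_{\mathcal A}$ is a complete intersection, and suppose that for some $1\le i<j\le n$ we have $a_i\in\mathrm{Cone}(\mathcal A\setminus\{a_i\})$, $a_j\in\mathrm{Cone}(\mathcal A\setminus\{a_j\})$ and $m_ia_i=m_ja_j$. Define $\mathcal A'=\{a'_1,\ldots,a'_{n-1}\}$ by $a'_r:=a_r$ for $r\in\{1,\ldots,j-1\}\setminus\{i\}$, $a'_r:=a_{r+1}$ for $r\in\{j,\ldots,n-1\}$, and $a'_i:=\gcd\{a_i,a_j\}$. Then: (1) $I_{\mathcal A'}$ is a complete intersection; (2) for every $r$ with $a'_r\in\mathrm{Cone}(\mathcal A'\setminus\{a'_r\})$, setting $m'_r:=\min\{b\in\mathbb Z^+ : b\,a'_r\in\sum_{t\in\{1,\ldots,n-1\},t\neq r}\mathbb N a'_t\}$, one has $m'_r=m_r$ if $r\in\{1,\ldots,j-1\}\setminus\{i\}$ and $m'_r=m_{r+1}$ if $r\in\{j,\ldots,n-1\}$.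
   Context: $k$ is an arbitrary field. For a finite list $\mathcal A=\{a_1,\ldots,a_n\}$ of nonzero vectors in $\mathbb N^m$, the toric ideal $I_{\mathcal A}\subset k[x_1,\ldots,x_n]$ is the kernel of the $k$-algebra homomorphism $x_i\mapsto t^{a_i}=t_1^{a_{i1}}\cdots t_m^{a_{im}}$ into $k[t_1,\ldots,t_m]$; its height is $n-\mathrm{rk}(\mathbb Z\mathcal A)$. An ideal is a complete intersection if its minimal number of generators equals its height. For a finite $\mathcal B\subset\mathbb N^m$, $\mathrm{Cone}(\mathcal B)$ is the set of nonnegative real linear combinations of elements of $\mathcal B$. Whenever $a_i\in\mathrm{Cone}(\mathcal A\setminus\{a_i\})$, $m_i:=\min\{b\in\mathbb Z^+ : b\,a_i\in\sum_{j\neq i}\mathbb N a_j\}$. For $a,b\in\mathbb N^m$ with $a=\lambda b$ for some $\lambda\in\mathbb Q$, $\gcd\{a,b\}\in\mathbb N^m$ is the vector whose $l$-th coordinate is $0$ if $a_l=b_l=0$ and $\gcd\{a_l,b_l\}$ otherwise. *)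

(* Defs.v *)
From HB Require Import structures.
From mathcomp Require Import all_boot all_order all_algebra.
From Stdlib Require Reals.

Set Implicit Arguments.
Unset Strict Implicit.
Unset Printing Implicit Defensive.

Import GRing.Theory.
Local Open Scope ring_scope.

Fixpoint mpoly (k : comNzRingType) (n : nat) : comNzRingType :=
  match n with
  | 0 => k
  | n'.+1 => {poly (mpoly k n')}
  end.

Fixpoint mC (k : comNzRingType) (m : nat) : k -> mpoly k m :=
  match m return k -> mpoly k m with
  | 0 => fun c => c
  | m'.+1 => fun c => (@mC k m' c)%:P
  end.

(* the variable x_l (0 <= l < m) of k[x_0..x_{m-1}] (0 if l >= m) *)
Fixpoint mX (k : comNzRingType) (m : nat) (l : nat) : mpoly k m :=
  match m return mpoly k m with
  | 0 => 0
  | m'.+1 => if l == m' then 'X else (@mX k m' l)%:P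
  end.

Fixpoint meval (k : comNzRingType) (m : nat) (v : nat -> mpoly k m) (n : nat)
  : mpoly k n -> mpoly k m :=
  match n return mpoly k n -> mpoly k m with
  | 0 => fun c => mC m c
  | n'.+1 => fun p : {poly (mpoly k n')} =>
      \sum_(d < size p) @meval k m v n' p`_d * v n' ^+ d
  end.

Definition tmon (k : comNzRingType) (m : nat) (a : nat -> nat) : mpoly k m :=
  \prod_(l < m) @mX k m l ^+ a l.

(* A = {a_0, ..., a_{n-1}} subset N^m is encoded by a : nat -> nat -> nat,
   a i l = l-th coordinate of a_i (only i < n, l < m matter). *)

Definition toric_ideal (k : comNzRingType) (n m : nat) (a : nat -> nat -> nat)
  : mpoly k n -> Prop :=
  fun f => meval (fun i => @tmon k m (a i)) f = 0.

Definition generates (R : comNzRingType) (I : R -> Prop) (gs : seq R) : Prop :=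
  forall f, I f <-> exists c : nat -> R, f = \sum_(t < size gs) c t * gs`_t.

Definition min_num_gens (R : comNzRingType) (I : R -> Prop) (h : nat) : Prop :=
  (exists gs, generates I gs /\ size gs = h) /\
  (forall gs, generates I gs -> (h <= size gs)%N).

(* rank of the lattice Z A = rank over Q of the n x m matrix with rows a_i *)
Definition rkA (n m : nat) (a : nat -> nat -> nat) : nat :=
  \rank (\matrix_(i < n, l < m) ((a i l)%:R : rat)).

Definition toric_height (n m : nat) (a : nat -> nat -> nat) : nat :=
  (n - rkA n m a)%N.

Definition toric_CI (k : comNzRingType) (n m : nat) (a : nat -> nat -> nat) : Prop :=
  min_num_gens (@toric_ideal k n m a) (toric_height n m a).

Definition nonzero_vec (m : nat) (v : nat -> nat) : Prop :=
  exists l, (l < m)%N /\ v l <> 0%N.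

Fixpoint rsum (f : nat -> Rdefinitions.R) (n : nat) : Rdefinitions.R :=
  match n with
  | 0 => Rdefinitions.R0
  | n'.+1 => Rdefinitions.Rplus (rsum f n') (f n')
  end.

Definition in_cone_except (n m : nat) (a : nat -> nat -> nat) (i : nat) : Prop :=
  exists lam : nat -> Rdefinitions.R,
    (forall j, Rdefinitions.Rle Rdefinitions.R0 (lam j)) /\
    forall l, (l < m)%N ->
      Raxioms.INR (a i l) =
      rsum (fun j => if j == i then Rdefinitions.R0
                     else Rdefinitions.Rmult (lam j) (Raxioms.INR (a j l))) n.

Definition in_semigroup_except (n m : nat) (a : nat -> nat -> nat) (i : nat)
  (v : nat -> nat) : Prop :=
  exists c : nat -> nat, forall l, (l < m)%N ->
    v l = (\sum_(j < n | j != i :> nat) c j * a j l)%N.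

Definition is_mult (n m : nat) (a : nat -> nat -> nat) (i b : nat) : Prop :=
  [/\ (0 < b)%N,
      in_semigroup_except n m a i (fun l => b * a i l)%N &
      forall b', (0 < b')%N -> in_semigroup_except n m a i (fun l => b' * a i l)%N ->
                 (b <= b')%N].

(* gcd{u,v} coordinatewise (gcdn 0 0 = 0) *)
Definition gcdv (u v : nat -> nat) : nat -> nat := fun l => gcdn (u l) (v l).

Definition contractA (a : nat -> nat -> nat) (i j : nat) : nat -> nat -> nat :=
  fun r => if r == i then gcdv (a i) (a j)
           else if (r < j)%N then a r else a r.+1.

Arguments toric_CI k n m a : clear implicits.
Arguments toric_ideal k n m a _ : clear implicits.

(* Main.v *)
(* Put q = m_i, p = m_j. Minimality forces gcd(p,q) = 1, so a_i = p e and a_j = q e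
   with e = gcd(a_i,a_j), and x_i |-> s^p, x_j |-> s^q defines phi : k[x] -> k[s,z]
   with phi^-1(I_A') = I_A. Minimality of m_i also makes x_i^q - x_j^p a minimal
   generator of I_A; it dies under phi, so phi(I_A) generates an ideal J of I_A' with
   h - 1 = ht(I_A') generators. Every f in I_A' has s^N f in J for large N, because
   large powers of s are monomials in s^p, s^q. Hence J = I_A' as soon as s is a
   nonzerodivisor modulo J. For this, J + (s) / (s) contains a regular sequence of
   length h - 1 by Noether normalisation, so the Koszul complex of the h - 1
   generators of J is acyclic modulo s in positive degrees: every syzygy modulo s is
   a Koszul syzygy, and s can be cancelled. The same acyclicity shows that the
   generators of J are minimal. Finally, a relation b a'_r = sum c_t a'_t gives a
   binomial in J, so x_r^b' with b' <= b occurs in some generator of I_A, which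
   compares m'_r with m_r. *)
Require Import Defs.
From HB Require Import structures.
From mathcomp Require Import all_boot all_order all_algebra.
From mathcomp Require Import zify Rstruct.
From Stdlib Require Import Classical_Prop Classical_Pred_Type.
Set Implicit Arguments.
Unset Strict Implicit.
Unset Printing Implicit Defensive.
Import GRing.Theory.
Local Open Scope ring_scope.

(** * Iterated polynomial rings *)

(** No dimension theory enters: height is used only through the rank. Any rk + 1 polynomials satisfy
    a polynomial relation modulo I_A, by counting monomials; hence any rk of them satisfy one modulo
    I_A + (x_i), because I_A is prime and contains no power of x_i. This relation survives phi
    followed by s = 0, and it is the hypothesis fed to the normalisation. The regular sequence found
    in this way need not consist of the chosen generators of J. Koszul exactness is the right tool
    because it only asks that the sequence lie in the ideal they span. That the binomial may be
    taken among h generators is linear algebra in I_A / m I_A, graded by giving x_l the total degree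
    of a_l: independent families have at most h elements, and a maximal homogeneous one generates.
    Existence of m'_r starts from a real cone; a real solution of minimal support is rational, and
    denominators can be cleared. *)

Section IteratedPolynomials.
Variable k : comNzRingType.

Fact mC_is_additive m : additive (@mC k m).
Proof.
by elim: m => [|m IH] x y //=; rewrite IH rmorphB.
Qed.

Fact mC_is_monoid_morphism m : monoid_morphism (@mC k m).
Proof.
elim: m => [|m [IH1 IHM]]; first by [].
by split=> [|x y] /=; rewrite ?IH1 ?IHM ?rmorph1 ?rmorphM.
Qed.

HB.instance Definition _ m :=
  GRing.isAdditive.Build k (mpoly k m) (@mC k m) (@mC_is_additive m).
HB.instance Definition _ m :=
  GRing.isMonoidMorphism.Build k (mpoly k m) (@mC k m)
    (@mC_is_monoid_morphism m).

Lemma mC_inj m : injective (@mC k m).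
Proof. by elim: m => [|m IH] x y //= /polyC_inj /IH. Qed.

Lemma mevalS m (v : nat -> mpoly k m) n (p : {poly mpoly k n}) :
  meval v (n := n.+1) p = (map_poly (meval v (n := n)) p).[v n].
Proof. by rewrite /map_poly horner_poly. Qed.

(** The recursion goes through [map_poly], which is a morphism only for a bundled argument; the
    existential carries such a bundle through the induction. *)
Fact meval_morph m (v : nat -> mpoly k m) n :
  exists g : {rmorphism mpoly k n -> mpoly k m}, meval v (n := n) =1 g.
Proof.
elim: n => [|n [g gE]]; first by exists (@mC k m).
exists (horner_eval (v n) \o map_poly g : {rmorphism {poly mpoly k n} -> _}).
by move=> p; rewrite mevalS (eq_map_poly gE).
Qed.

Fact meval_is_additive m (v : nat -> mpoly k m) n : additive (meval v (n := n)).
Proof. by have [g gE] := meval_morph v n => x y; rewrite !gE rmorphB. Qed.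

Fact meval_is_monoid_morphism m (v : nat -> mpoly k m) n :
  monoid_morphism (meval v (n := n)).
Proof.
have [g gE] := meval_morph v n.
by split=> [|x y]; rewrite !gE ?rmorph1 ?rmorphM.
Qed.

HB.instance Definition _ m (v : nat -> mpoly k m) n :=
  GRing.isAdditive.Build (mpoly k n) (mpoly k m) (meval v (n := n))
    (@meval_is_additive m v n).
HB.instance Definition _ m (v : nat -> mpoly k m) n :=
  GRing.isMonoidMorphism.Build (mpoly k n) (mpoly k m) (meval v (n := n))
    (@meval_is_monoid_morphism m v n).

Lemma meval_mC m (v : nat -> mpoly k m) n c :
  meval v (mC n c) = mC m c.
Proof.
elim: n => [|n IH] //.
by rewrite mevalS /= map_polyC hornerC /= IH.
Qed.

Lemma meval_mX m (v : nat -> mpoly k m) n l :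
  (l < n)%N -> meval v (mX k n l) = v l.
Proof.
elim: n => [|n IH] // ; rewrite ltnS leq_eqVlt mevalS /=.
have [-> _|nln /= ln] := eqVneq l n; first by rewrite map_polyX hornerX.
by rewrite map_polyC hornerC /= IH.
Qed.

Lemma mpoly_ind_ring n (Q : mpoly k n -> Prop) :
  (forall c, Q (mC n c)) -> (forall l, (l < n)%N -> Q (mX k n l)) ->
  (forall f g, Q f -> Q g -> Q (f + g)) ->
  (forall f g, Q f -> Q g -> Q (f * g)) -> forall f, Q f.
Proof.
elim: n Q => [|n IH] Q QC QX QD QM f; first exact: QC.
have Qc (c : mpoly k n) : Q (c%:P).
  elim/IH: c => [c|l ln|c d Qc Qd|c d Qc Qd].
  - exact: QC.
  - have := QX l (ltnW ln); rewrite /= ltn_eqF //.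
  - by rewrite rmorphD; apply: QD.
  - by rewrite rmorphM; apply: QM.
elim/poly_ind: f => [|p c Qp]; first exact: (Qc 0).
apply: QD => //; apply: QM => //.
by have := QX n (ltnSn n); rewrite /= eqxx.
Qed.

Lemma eq_rmorph_mpoly n (S : nzRingType) (g h : {rmorphism mpoly k n -> S}) :
  (forall c, g (mC n c) = h (mC n c)) ->
  (forall l, (l < n)%N -> g (mX k n l) = h (mX k n l)) -> g =1 h.
Proof.
move=> gC gX; apply: mpoly_ind_ring => // f1 f2 e1 e2.
  by rewrite !rmorphD e1 e2.
by rewrite !rmorphM e1 e2.
Qed.

Lemma eq_meval m (v w : nat -> mpoly k m) n :
  (forall l, (l < n)%N -> v l = w l) -> meval v (n := n) =1 meval w (n := n).
Proof.
move=> vw; apply: eq_rmorph_mpoly => [c|l ln] /=.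
  by rewrite !meval_mC.
by rewrite !meval_mX // vw.
Qed.

Lemma meval_comp m p n (v : nat -> mpoly k m) (w : nat -> mpoly k p)
    (f : mpoly k n) :
  meval w (meval v f) = meval (fun l => meval w (v l)) f.
Proof.
move: f; apply: (@eq_rmorph_mpoly _ _ (meval w (n := m) \o meval v (n := n)))
  => [c|l ln] /=; first by rewrite !meval_mC.
by rewrite !meval_mX.
Qed.

Lemma meval_id n (f : mpoly k n) : meval (mX k n) f = f.
Proof.
move: f; apply: (@eq_rmorph_mpoly _ _ (meval (mX k n) (n := n)) idfun)
  => [c|l ln] /=; by rewrite ?meval_mC ?meval_mX.
Qed.

Lemma eq_tmon m (a b : nat -> nat) :
  (forall l, (l < m)%N -> a l = b l) -> tmon k m a = tmon k m b.
Proof. by move=> ab; apply: eq_bigr => l _; rewrite ab. Qed.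

Lemma tmonD m (a b : nat -> nat) :
  tmon k m (fun l => (a l + b l)%N) = tmon k m a * tmon k m b.
Proof. by rewrite -big_split; apply: eq_bigr => l _; rewrite exprD. Qed.

Lemma tmon0 m (a : nat -> nat) :
  (forall l, (l < m)%N -> a l = 0%N) -> tmon k m a = 1.
Proof. by move=> a0; apply: big1 => l _; rewrite a0. Qed.

Lemma tmonMn m (a : nat -> nat) d :
  tmon k m (fun l => (d * a l)%N) = tmon k m a ^+ d.
Proof. by rewrite -prodrXl; apply: eq_bigr => l _; rewrite mulnC exprM. Qed.

Lemma tmon_sum m I (r : seq I) (P : pred I) (a : I -> nat -> nat) :
  tmon k m (fun l => \sum_(x <- r | P x) a x l)%N =
  \prod_(x <- r | P x) tmon k m (a x).
Proof.
rewrite exchange_big /=; apply: eq_bigr => l _.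
by rewrite (big_morph (fun d => mX k m l ^+ d) (exprD _) (expr0 _)).
Qed.

Lemma tmon_mX m j : (j < m)%N -> tmon k m (fun l => (l == j) : nat) = mX k m j.
Proof.
move=> jm; rewrite /tmon (bigD1 (Ordinal jm)) //= eqxx expr1 big1 ?mulr1 //.
by move=> l /negbTE; rewrite -val_eqE /= => ->.
Qed.

Lemma tmonS m (a : nat -> nat) :
  tmon k m.+1 a = (tmon k m a)%:P * 'X^(a m).
Proof.
rewrite /tmon big_ord_recr /= eqxx rmorph_prod; congr (_ * _).
by apply: eq_bigr => l _; rewrite /= rmorphXn (ltn_eqF (ltn_ord l)).
Qed.

Lemma meval_tmon m n (v : nat -> mpoly k m) (u : nat -> nat) :
  meval v (tmon k n u) = \prod_(l < n) v l ^+ u l.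
Proof.
by rewrite rmorph_prod; apply: eq_bigr => l _; rewrite rmorphXn /= meval_mX.
Qed.

(* exponent of t in the image of x^u *)
Definition mdeg n (a : nat -> nat -> nat) (u : nat -> nat) : nat -> nat :=
  fun l => (\sum_(r < n) u r * a r l)%N.

Lemma meval_tmon_tmon m n a (u : nat -> nat) :
  meval (fun r => tmon k m (a r)) (tmon k n u) = tmon k m (mdeg n a u).
Proof.
rewrite meval_tmon tmon_sum; apply: eq_bigr => l _.
by rewrite tmonMn.
Qed.

Fixpoint mcoef n (u : nat -> nat) : mpoly k n -> k :=
  match n return mpoly k n -> k with
  | 0 => id
  | n'.+1 => fun f : {poly mpoly k n'} => mcoef u f`_(u n')
  end.

Fact mcoef_is_additive n u : additive (@mcoef n u).
Proof. by elim: n => [|n IH] f g //=; rewrite coefB IH. Qed.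

HB.instance Definition _ n u :=
  GRing.isAdditive.Build (mpoly k n) k (@mcoef n u) (@mcoef_is_additive n u).

Lemma mcoefCM n u c (f : mpoly k n) : mcoef u (mC n c * f) = c * mcoef u f.
Proof. by elim: n f => [|n IH] f //=; rewrite coefCM IH. Qed.

Lemma mcoef_tmon n u (a : nat -> nat) :
  mcoef u (tmon k n a) = [forall l : 'I_n, a l == u l]%:R.
Proof.
elim: n => [|n IH]; first by rewrite /tmon big_ord0; case: forallP => // -[] [].
rewrite tmonS /= coefCM coefXn.
have -> : [forall l : 'I_n.+1, a l == u l] =
  [forall l : 'I_n, a l == u l] && (u n == a n).
  apply/forallP/andP => [h|[/forallP h /eqP h'] l].
    split; last by rewrite eq_sym; exact: (h ord_max).
    by apply/forallP => l; exact: (h (widen_ord (leqnSn n) l)).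
  have := ltn_ord l; rewrite ltnS leq_eqVlt => /orP [/eqP ->|ln].
    by rewrite h'.
  exact: (h (Ordinal ln)).
case: eqP => _; rewrite ?andbT ?andbF ?mulr1 ?mulr0 ?raddf0 //.
Qed.

Lemma eq_mcoef n (u v : nat -> nat) (f : mpoly k n) :
  (forall l, (l < n)%N -> u l = v l) -> mcoef u f = mcoef v f.
Proof.
elim: n f => [|n IH] f uv //=.
by rewrite uv // IH // => l ln; rewrite uv // ltnW.
Qed.

Lemma mcoef_eq0 n (f : mpoly k n) : (forall u, mcoef u f = 0) -> f = 0.
Proof.
elim: n f => [|n IH] f h; first exact: (h (fun=> 0%N)).
apply/polyP => d; rewrite coef0; apply: IH => u.
have := h (fun l => if l == n then d else u l); rewrite /= eqxx => <-.
by apply: eq_mcoef => l /ltn_eqF ->.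
Qed.

(* exponents may repeat in L *)
Lemma mpoly_expand n (f : mpoly k n) :
  exists L : seq (k * (nat -> nat)), f = \sum_(x <- L) mC n x.1 * tmon k n x.2.
Proof.
elim/mpoly_ind_ring: f => [c|l ln|f g [L ->] [M ->]|f g [L ->] [M ->]].
- by exists [:: (c, fun=> 0%N)]; rewrite big_seq1 tmon0 // mulr1.
- exists [:: (1, fun l' => (l' == l) : nat)].
  by rewrite big_seq1 tmon_mX // rmorph1 mul1r.
- by exists (L ++ M); rewrite big_cat.
- exists [seq (x.1 * y.1, fun l => (x.2 l + y.2 l)%N) | x <- L, y <- M].
  rewrite big_allpairs_dep mulr_suml; apply: eq_bigr => x _.
  rewrite mulr_sumr; apply: eq_bigr => y _ /=.
  by rewrite tmonD rmorphM mulrACA.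
Qed.

End IteratedPolynomials.

(** [mpoly k n] is only declared a commutative ring, even over a field; cancellation comes from the
    product of leading coefficients, one variable at a time. *)
Lemma mpoly_mul_eq0 (k : fieldType) n (f g : mpoly k n) :
  f * g = 0 -> f = 0 \/ g = 0.
Proof.
elim: n f g => [|n IH] f g.
  by move/eqP; rewrite mulf_eq0 => /orP [] /eqP ->; [left|right].
move=> fg; have [->|f0] := eqVneq (f : {poly mpoly k n}) 0; first by left.
have [->|g0] := eqVneq (g : {poly mpoly k n}) 0; first by right.
case: (@eqP _ (lead_coef (f : {poly mpoly k n}) * lead_coef (g : {poly mpoly k n})) 0).
  by case/IH => /eqP; rewrite lead_coef_eq0 ?(negPf f0) ?(negPf g0).
move/eqP => nz; have := lead_coef_proper_mul nz.
by rewrite -[X in lead_coef X]/(f * g) fg lead_coef0 => e; rewrite -e eqxx in nz.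
Qed.

(** * Regular sequences and the Koszul complex *)

Section Ideals.
Variable R : comNzRingType.

Definition is_ideal (N : R -> Prop) :=
  [/\ N 0, forall x y, N x -> N y -> N (x + y) & forall x y, N y -> N (x * y)].

Lemma ideal_opp N x : is_ideal N -> N x -> N (- x).
Proof. by case=> _ _ NM Nx; rewrite -mulN1r; apply: NM. Qed.

Lemma ideal_sub N x y : is_ideal N -> N x -> N y -> N (x - y).
Proof. by move=> iN Nx Ny; have [_ ND _] := iN; apply: ND => //; exact: ideal_opp. Qed.

Lemma ideal_sum N I (r : seq I) (F : I -> R) : is_ideal N ->
  (forall x, N (F x)) -> N (\sum_(x <- r) F x).
Proof. by case=> N0 ND _ NF; apply: (big_ind N) => // t _; apply: NF. Qed.

Definition span_ideal (gs : seq R) (f : R) : Prop :=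
  exists c : nat -> R, f = \sum_(t < size gs) c t * gs`_t.

Lemma span_ideal_nil f : span_ideal [::] f <-> f = 0.
Proof.
by split=> [[c ->]|->]; first exact: big_ord0; exists (fun=> 0); rewrite big_ord0.
Qed.

Lemma span_ideal_cons g gs f :
  span_ideal (g :: gs) f <-> exists b f', f = b * g + f' /\ span_ideal gs f'.
Proof.
split=> [[c ->]|[b [_ [-> [c ->]]]]].
  exists (c 0%N), (\sum_(t < size gs) c t.+1 * gs`_t).
  by rewrite big_ord_recl; split=> //; exists (fun t => c t.+1).
exists (fun t => if t is t'.+1 then c t' else b).
by rewrite big_ord_recl.
Qed.

Lemma span_ideal_is_ideal gs : is_ideal (span_ideal gs).
Proof.
split=> [|_ _ [c ->] [d ->]|x _ [c ->]].
- by exists (fun=> 0); rewrite big1 // => t _; rewrite mul0r.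
- by exists (fun t => c t + d t); rewrite -big_split; apply: eq_bigr => t _; rewrite mulrDl.
- by exists (fun t => x * c t); rewrite mulr_sumr; apply: eq_bigr => t _; rewrite mulrA.
Qed.

Lemma span_ideal_nth gs t : (t < size gs)%N -> span_ideal gs gs`_t.
Proof.
move=> ts; exists (fun u => (u == t)%:R).
rewrite (bigD1 (Ordinal ts)) //= eqxx mul1r big1 ?addr0 // => u.
by rewrite -val_eqE /= => /negbTE ->; rewrite mul0r.
Qed.

Lemma span_ideal_min N gs f : is_ideal N ->
  (forall t, (t < size gs)%N -> N gs`_t) -> span_ideal gs f -> N f.
Proof.
move=> iN Ngs [c ->]; have [N0 ND NM] := iN.
by apply: (big_ind N) => // t _; apply: NM; apply: Ngs.
Qed.

Definition add_gen (N : R -> Prop) (a : R) : R -> Prop :=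
  fun x => exists y z, N y /\ x = y + a * z.

Lemma add_gen_ideal N a : is_ideal N -> is_ideal (add_gen N a).
Proof.
case=> N0 ND NM; split=> [|_ _ [y [z [Ny ->]]] [y' [z' [Ny' ->]]]|x _ [y [z [Ny ->]]]].
- by exists 0, 0; rewrite mulr0 addr0.
- by exists (y + y'), (z + z'); split; [exact: ND | rewrite mulrDr addrACA].
- by exists (x * y), (x * z); split; [exact: NM | rewrite mulrDr mulrCA].
Qed.

Lemma add_gen_sub N a x : N x -> add_gen N a x.
Proof. by move=> Nx; exists x, 0; rewrite mulr0 addr0. Qed.

(** Weak regularity: the quotient may become zero, so a unit is an admissible entry. Only
    cancellation is ever exploited. *)
Fixpoint regular_seq (N : R -> Prop) (s : seq R) : Prop :=
  if s is a :: s' then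
    (forall x, N (a * x) -> N x) /\ regular_seq (add_gen N a) s'
  else True.

End Ideals.

Lemma eq_regular_seq (R : comNzRingType) (N N' : R -> Prop) s :
  (forall x, N x <-> N' x) -> regular_seq N s -> regular_seq N' s.
Proof.
elim: s N N' => [|a s IH] N N' NN' //= [ra rs]; split=> [x /NN' /ra /NN' //|].
apply: IH rs => x.
by split=> -[y [z [Ny ->]]]; exists y, z; split=> //; apply/NN'.
Qed.

(* The Koszul complex K(f_1, ..., f_r) as an iterated mapping cone, all degrees
   at once; [kdeg i] singles out the elements of homological degree i. *)
Section Koszul.
Variable R : comNzRingType.

Fixpoint kos (r : nat) : lmodType R :=
  match r with 0 => R^o | r'.+1 => (kos r' * kos r')%type end.

Fixpoint kdiff (fs : seq R) : kos (size fs) -> kos (size fs) :=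
  match fs return kos (size fs) -> kos (size fs) with
  | [::] => fun _ => 0
  | f :: fs' => fun c => (kdiff c.1 + f *: c.2, - kdiff c.2)
  end.

Fact kdiff_linear fs : linear (@kdiff fs).
Proof.
elim: fs => [|f fs IH] a u v /=; first by rewrite scaler0 addr0.
have /= e1 := IH a u.1 v.1; have /= e2 := IH a u.2 v.2.
congr pair; rewrite /=.
  by rewrite e1 !scalerDr !scalerA mulrC addrACA.
by rewrite e2 opprD scalerN.
Qed.

HB.instance Definition _ fs :=
  GRing.isLinear.Build R (kos (size fs)) (kos (size fs)) *:%R (@kdiff fs)
    (@kdiff_linear fs).

Lemma kdiffK fs c : @kdiff fs (kdiff c) = 0.
Proof.
elim: fs c => [c|f fs IH [u v]] //=.
by rewrite (linearD (@kdiff fs)) (linearZ_LR (@kdiff fs)) (linearN (@kdiff fs)) /=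
  !IH add0r scalerN subrr !oppr0.
Qed.

Fixpoint kdeg (i : nat) (r : nat) : kos r -> Prop :=
  match r return kos r -> Prop with
  | 0 => fun c => i = 0%N \/ c = 0
  | r'.+1 => fun c => kdeg i c.1 /\ (if i is i'.+1 then kdeg i' c.2 else c.2 = 0)
  end.

(** Chains with all coordinates in [N]. Computing modulo [kin N] stands for the Koszul complex over
    the quotient by [N], without forming that quotient. *)
Fixpoint kin (N : R -> Prop) (r : nat) : kos r -> Prop :=
  match r return kos r -> Prop with
  | 0 => fun c => N c
  | r'.+1 => fun c => kin N c.1 /\ kin N c.2
  end.

Lemma kdeg0 i r : kdeg i (0 : kos r).
Proof.
by elim: r i => [|r IH] i /=; [right | split=> //; case: i].
Qed.

Lemma kdegD i r (u v : kos r) : kdeg i u -> kdeg i v -> kdeg i (u + v).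
Proof.
elim: r i u v => [|r IH] i u v /=.
  by case=> [->|->]; [left | rewrite add0r].
case: i => [|i] [u1 u2] [v1 v2]; split; try exact: IH.
by rewrite u2 v2 addr0.
Qed.

Lemma kdegZ i r a (u : kos r) : kdeg i u -> kdeg i (a *: u).
Proof.
elim: r i u => [|r IH] i u /=.
  by case=> [->|->]; [left | right; rewrite scaler0].
case: i => [|i] [u1 u2]; split; try exact: IH.
by rewrite u2 scaler0.
Qed.

Lemma kdegN i r (u : kos r) : kdeg i u -> kdeg i (- u).
Proof. by rewrite -scaleN1r; apply: kdegZ. Qed.

Lemma kdeg_large i r (u : kos r) : (r < i)%N -> kdeg i u -> u = 0.
Proof.
elim: r i u => [|r IH] [|i] u //=; first by move=> _ [].
move=> ri [u1 u2]; case: u u1 u2 => u v /= u1 u2.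
by rewrite (IH _ _ (ltnW ri) u1) (IH _ _ ri u2).
Qed.

Lemma kdiff_deg0 fs (v : kos (size fs)) : kdeg 0 v -> kdiff v = 0.
Proof.
elim: fs v => [v|f fs IH [u v]] //= [du ->].
by rewrite IH // scaler0 linear0 oppr0 addr0.
Qed.

Lemma kdiff_deg i fs c : kdeg i.+1 c -> kdeg i (@kdiff fs c).
Proof.
elim: fs i c => [i c|f fs IH i [u v]] /=; first by move=> _; right.
case=> du dv; split; first by apply: kdegD; [exact: IH | exact: kdegZ].
case: i dv {du} => [|i] dv; last by apply/kdegN/IH.
by rewrite kdiff_deg0 // oppr0.
Qed.

Section InN.
Variables (N : R -> Prop) (iN : is_ideal N).

Lemma kin0 r : kin N (0 : kos r).
Proof. by have [N0 _ _] := iN; elim: r => [|r IH] //=. Qed.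

Lemma kinD r (u v : kos r) : kin N u -> kin N v -> kin N (u + v).
Proof.
have [_ ND _] := iN.
elim: r u v => [|r IH] u v /=; first exact: ND.
by case=> u1 u2 [v1 v2]; split; apply: IH.
Qed.

Lemma kinZ r a (u : kos r) : kin N u -> kin N (a *: u).
Proof.
have [_ _ NM] := iN.
elim: r u => [|r IH] u /=; first exact: NM.
by case=> u1 u2; split; apply: IH.
Qed.

Lemma kinZN r a (u : kos r) : N a -> kin N (a *: u).
Proof.
have [_ _ NM] := iN; move=> Na.
elim: r u => [|r IH] u /=; last by split; apply: IH.
by rewrite -[_ *: _]/(a * u) mulrC; exact: NM.
Qed.

Lemma kinN r (u : kos r) : kin N u -> kin N (- u).
Proof. by rewrite -scaleN1r; apply: kinZ. Qed.

Lemma kin_kdiff fs c : kin N c -> kin N (@kdiff fs c).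
Proof.
elim: fs c => [c|f fs IH [u v]] /=; first by move=> _; have [] := iN.
by case=> Nu Nv; split; [apply: kinD; [exact: IH|exact: kinZ] | apply/kinN/IH].
Qed.

Lemma kin_add_gen i a r (x : kos r) : kdeg i x -> kin (add_gen N a) x ->
  exists v n, [/\ kdeg i v, kin N n & x = n + a *: v].
Proof.
elim: r i x => [|r IH] i x /=.
  case=> [-> [y [z [Ny ->]]]|-> _]; first by exists z, y; split=> //; left.
  by exists 0, 0; split=> //; [right|case: iN|rewrite scaler0 addr0].
case: x => [x1 x2] /= [d1 d2] [N1 N2].
have [v1 [n1 [dv1 Nn1 ->]]] := IH _ _ d1 N1.
case: i d1 d2 dv1 => [|i] d1 d2 dv1.
  exists (v1, 0), (n1, 0); split=> //; first by split=> //; exact: kin0.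
  by rewrite d2; congr pair; rewrite /= ?scaler0 ?addr0.
have [v2 [n2 [dv2 Nn2 ->]]] := IH _ _ d2 N2.
by exists (v1, v2), (n1, n2); split.
Qed.

Lemma kin_nzd a r (x : kos r) :
  (forall y, N (a * y) -> N y) -> kin N (a *: x) -> kin N x.
Proof.
move=> ra; elim: r x => [|r IH] x /=; first exact: ra.
by case=> x1 x2; split; apply: IH.
Qed.

End InN.

Lemma kdiff_in_span N fs c : is_ideal N -> (forall t, (t < size fs)%N -> N fs`_t) ->
  kin N (@kdiff fs c).
Proof.
move=> iN; elim: fs c => [c|f fs IH [u v]] h /=; try by case: iN.
have hfs t : (t < size fs)%N -> N fs`_t by exact: (h t.+1).
split; last by apply: kinN => //; exact: IH.
by apply: kinD => //; [exact: IH|apply: kinZN => //; exact: (h 0%N)].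
Qed.

(** Elements of the ideal act as zero on Koszul homology. The homotopy is exterior multiplication by
    a coefficient vector of [a]; on the cone it sends (u, v) to (h u, b u - h v). *)
Lemma koszul_homotopy fs a : span_ideal fs a ->
  exists h : {linear kos (size fs) -> kos (size fs)},
  [/\ forall c, kdiff (h c) + h (kdiff c) = a *: c,
      forall i c, kdeg i c -> kdeg i.+1 (h c) &
      forall N c, is_ideal N -> kin N c -> kin N (h c)].
Proof.
elim: fs a => [|f fs IH] a.
  move/span_ideal_nil => ->; exists (\0 : {linear R^o -> R^o}).
  split=> [c|i c _|N c [] //].
    by rewrite scale0r /= addr0.
  by right.
case/span_ideal_cons => b [a' [-> /IH [h [hE hd hN]]]].
pose H (c : kos (size (f :: fs))) : kos (size (f :: fs)) := (h c.1, b *: c.1 - h c.2).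
have H_linear : linear H.
  move=> t [u1 u2] [v1 v2]; rewrite /H /= !(linearP h); congr pair.
  by rewrite /= scalerDr opprD addrACA scalerBr !scalerA mulrC.
pose lH := GRing.isLinear.Build R _ _ _ H H_linear.
pose HL : {linear kos (size (f :: fs)) -> kos (size (f :: fs))} := HB.pack H lH.
exists HL; split=> [[u v]|i [u v]|N [u v] iN] /=; rewrite {}/HL /= /H /=.
- congr pair.
    rewrite /= (linearD h) (linearZ_LR h) /= scalerBr.
    have Z1 (V : zmodType) (x y z t : V) : x + (y - z) + (t + z) = x + t + y.
      by rewrite addrACA subrK addrAC -addrA (addrC y) addrA.
    by rewrite Z1 hE scalerA (mulrC f) addrC -scalerDl.
  rewrite /= (linearN h) (linearB (@kdiff fs)) (linearZ_LR (@kdiff fs)) /= opprK scalerDr.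
  have Z2 (V : zmodType) (x y z t : V) : - (y - x) + (y + z + t) = x + t + z.
    by rewrite opprB -(addrA y) (addrA (x - y)) subrK (addrC z) addrA.
  by rewrite Z2 hE scalerA addrC -scalerDl.
- case=> du dv; split; first exact: hd.
  apply: kdegD; first exact: kdegZ.
  case: i dv {du} => [->|i dv]; first by rewrite linear0 oppr0; exact: kdeg0.
  exact/kdegN/hd.
- case=> Nu Nv; split; first exact: hN.
  by apply: kinD => //; [exact: kinZ | apply: kinN => //; exact: hN].
Qed.

Definition koszul_exact fs i N :=
  forall c : kos (size fs), kdeg i c -> kin N (@kdiff fs c) ->
  exists c', kdeg i.+1 c' /\ kin N (c - kdiff c').

(** Depth sensitivity of the Koszul complex. For a cycle [c] modulo [N], the chain [h c] is a cycle
    modulo [N] and [a], one degree higher, where the shorter sequence already gives exactness; the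
    resulting identity is then divided by [a]. *)
Lemma koszul_exact_regular fs i N s : is_ideal N -> regular_seq N s ->
  (forall t, (t < size s)%N -> span_ideal fs s`_t) -> (size fs < i + size s)%N ->
  koszul_exact fs i N.
Proof.
elim: s i N => [|a s IH] i N iN /=.
  (* With the sequence exhausted, the size bound puts [i] above the top degree, so [c] is zero. *)
  move=> _ _; rewrite addn0 => si c dc _; exists 0; split; first exact: kdeg0.
  by rewrite (kdeg_large si dc) linear0 subr0; exact: kin0.
case=> ra rs fas si c dc Nc.
have [h [hE hd hN]] := koszul_homotopy (fas 0%N isT).
have iN' := add_gen_ideal a iN.
have /(IH i.+1 _ iN' rs)exa : forall t, (t < size s)%N -> span_ideal fs s`_t.
  by move=> t ts; exact: (fas t.+1).
rewrite addSnnS in exa.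
have [|w' [dw' Nw']] := exa si (h c) (hd _ _ dc).
  have -> : kdiff (h c) = a *: c - h (kdiff c) by rewrite -hE addrK.
  apply: kinD => //.
    by apply: kinZN => //; exists 0, 1; rewrite mulr1 add0r; split=> //; case: iN.
  apply: kinN => //; apply: hN => //; elim: (size fs) (kdiff c) Nc => [|r IHr] x /=.
    exact: add_gen_sub.
  by case=> x1 x2; split; apply: IHr.
have [|v [n [dv Nn wE]]] := kin_add_gen iN _ Nw' (i := i.+1).
  by apply: kdegD; [exact: hd | apply/kdegN/kdiff_deg].
exists v; split=> //; apply: (kin_nzd (a := a)) => //.
(* Applying the differential removes the boundary of [w']; since [kdiff (h c)] is [a *: c] up to
   [N], this gives [a *: (c - kdiff v)] in [N]. *)
have : kdiff (h c) = kdiff n + a *: kdiff v.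
  by rewrite -linearZ -linearD -wE linearB /= kdiffK subr0.
move=> e; rewrite scalerBr -hE e.
have -> : kdiff n + a *: kdiff v + h (kdiff c) - a *: kdiff v = kdiff n + h (kdiff c).
  by rewrite addrAC addrK.
by apply: kinD => //; [exact: kin_kdiff | exact: hN].
Qed.

(** [kscal] and [kvec] embed ring elements and coefficient vectors as the chains of degree 0 and 1.
    Through [kdiff_kvec], exactness in degree 1 becomes a statement on syzygies. *)
Fixpoint kscal r (x : R) : kos r :=
  match r return kos r with 0 => x | r'.+1 => (kscal r' x, 0) end.

Fixpoint kvec r (c : nat -> R) : kos r :=
  match r return kos r with
  | 0 => 0
  | r'.+1 => (kvec r' (fun t => c t.+1), kscal r' (c 0%N))
  end.

Lemma kscalD r x y : kscal r (x + y) = kscal r x + kscal r y.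
Proof. by elim: r => [|r IH] //=; rewrite IH; congr pair; rewrite /= addr0. Qed.

Lemma kscalZ r a x : kscal r (a * x) = a *: kscal r x.
Proof. by elim: r => [|r IH] //=; rewrite IH; congr pair; rewrite /= scaler0. Qed.

Lemma kscal_inj r : injective (kscal r).
Proof. by elim: r => [|r IH] x y //= [/IH]. Qed.

Lemma kdiff_kscal fs x : @kdiff fs (kscal (size fs) x) = 0.
Proof. by elim: fs => [|f fs IH] //=; rewrite IH scaler0 addr0 linear0 oppr0. Qed.

Lemma kdiff_kvec fs c :
  kdiff (kvec (size fs) c) = kscal (size fs) (\sum_(t < size fs) c t * fs`_t).
Proof.
elim: fs c => [|f fs IH] c /=; first by rewrite big_ord0.
rewrite kdiff_kscal oppr0 IH big_ord_recl /= addrC; congr pair.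
by rewrite kscalD mulrC kscalZ.
Qed.

Lemma kin_kscal N r x : is_ideal N -> kin N (kscal r x) <-> N x.
Proof.
move=> iN; elim: r => [|r IH] //=; split=> [[/IH //]|/IH Nx].
by split=> //; exact: kin0.
Qed.

Lemma kin_kvec N r c : is_ideal N ->
  kin N (kvec r c) -> forall t, (t < r)%N -> N (c t).
Proof.
move=> iN; elim: r c => [|r IH] c //= [/IH Nc /(kin_kscal _ _ iN) N0] [|t] //.
exact: Nc.
Qed.

Lemma kdeg_kscal r x : kdeg 0 (kscal r x).
Proof. by elim: r => [|r IH] /=; [left|]. Qed.

Lemma kdeg_kvec r c : kdeg 1 (kvec r c).
Proof.
elim: r c => [|r IH] c /=; first by right.
by split; [exact: IH | exact: kdeg_kscal].
Qed.

Lemma kdeg0_kscal r (v : kos r) : kdeg 0 v -> exists x, v = kscal r x.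
Proof.
elim: r v => [|r IH] v /=; first by exists v.
by case: v => v1 v2 /= [/IH [x ->] ->]; exists x.
Qed.

Lemma kdeg1_kvec r (v : kos r) : kdeg 1 v -> exists b, v = kvec r b.
Proof.
elim: r v => [|r IH] v /=; first by case=> // ->; exists (fun=> 0).
case: v => v1 v2 /= [/IH [b ->] /kdeg0_kscal [x ->]].
by exists (fun t => if t is t'.+1 then b t' else x).
Qed.

Section Consequences.
Variables (fs s : seq R) (x : R).
Let N : R -> Prop := fun y => exists z, y = x * z.
Hypotheses (rs : regular_seq N s) (size_s : (size fs <= size s)%N).
Hypothesis fs_s : forall t, (t < size s)%N -> span_ideal fs s`_t.

Let iN : is_ideal N.
Proof.
split=> [|_ _ [y ->] [z ->]|y _ [z ->]]; first by exists 0; rewrite mulr0.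
  by exists (y + z); rewrite mulrDr.
by exists (y * z); rewrite mulrCA.
Qed.

Let exact1 : koszul_exact fs 1 N.
Proof. by apply: (koszul_exact_regular iN rs). Qed.

(** The coefficients expressing [x * w] form a cycle modulo [x], hence a boundary plus [x] times a
    chain of degree 1. Boundaries contribute nothing, and [x] cancels. *)
Lemma span_ideal_nzd w : (forall y, x * y = 0 -> y = 0) ->
  span_ideal fs (x * w) -> span_ideal fs w.
Proof.
move=> rx [c xw].
have [|c' [dc' Nc']] := exact1 (kdeg_kvec (size fs) c).
  by rewrite kdiff_kvec -xw; apply/kin_kscal => //; exists w.
(* Viewing (x) as the zero ideal enlarged by [x] lets [kin_add_gen] extract an actual factor [x]. *)
have N0 : forall y, N y -> add_gen (fun y => y = 0) x y.
  by move=> _ [z ->]; exists 0, z; rewrite add0r.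
have {}Nc' : kin (add_gen (fun y => y = 0) x) (kvec (size fs) c - kdiff c').
  elim: (size fs) (_ - _) Nc' => [|r IH] u /=; first exact: N0.
  by case=> u1 u2; split; apply: IH.
have i0 : is_ideal (fun y : R => y = 0).
  by split=> [//|_ _ -> ->|y _ ->]; rewrite ?addr0 ?mulr0.
have [|v [n [dv n0 cE]]] := kin_add_gen i0 _ Nc' (i := 1%N).
  by apply: kdegD; [exact: kdeg_kvec | apply/kdegN/kdiff_deg].
have kin_eq0 r (u : kos r) : kin (fun y => y = 0) u -> u = 0.
  by elim: r u => [|r IH [u1 u2]] //= [/IH -> /IH ->].
move/kin_eq0 in n0.
have [b vE] := kdeg1_kvec dv.
exists b; apply/eqP; rewrite -subr_eq0; apply/eqP/rx.
rewrite mulrBr; apply/eqP; rewrite subr_eq0; apply/eqP/(@kscal_inj (size fs)).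
rewrite xw kscalZ -!kdiff_kvec -vE.
have /(congr1 (@kdiff fs)) := cE.
by rewrite n0 add0r (linearB (@kdiff fs)) (linearZ_LR (@kdiff fs)) /= kdiffK subr0.
Qed.

(** Modulo [x] every syzygy is a boundary, and boundaries have coefficients in the ideal of the
    generators. With [M] the ideal of the origin this yields minimality. *)
Lemma syzygy_coef_in (c : nat -> R) (M : R -> Prop) : is_ideal M -> M x ->
  (forall t, (t < size fs)%N -> M fs`_t) ->
  N (\sum_(t < size fs) c t * fs`_t) -> forall t, (t < size fs)%N -> M (c t).
Proof.
move=> iM Mx Mfs Nc; apply: kin_kvec => //.
have [|c' [_ Nc']] := exact1 (kdeg_kvec (size fs) c).
  by rewrite kdiff_kvec; apply/kin_kscal.
rewrite -(subrK (kdiff c') (kvec _ c)); apply: kinD => //.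
  have [_ _ MM] := iM.
  elim: (size fs) (_ - _) Nc' => [|r IH] u /=; last by case=> u1 u2; split; apply: IH.
  by case=> z ->; rewrite mulrC; apply: MM.
exact: kdiff_in_span.
Qed.

End Consequences.

End Koszul.

(** * Noether normalisation *)

(** Serves twice: for an automorphism changing variables, and for setting the gcd variable to
    zero. *)
Lemma regular_seq_lift (S R : comNzRingType) (eps : {rmorphism S -> R}) N s :
  (forall y, exists x, eps x = y) ->
  regular_seq N (map eps s) -> regular_seq (fun x => N (eps x)) s.
Proof.
move=> eps_surj; elim: s N => [|a s IH] N //= [ra rs]; split.
  by move=> x; rewrite rmorphM; apply: ra.
apply: eq_regular_seq (IH _ rs) => x; split=> [[y [z [Ny xE]]]|[y [z [Ny ->]]]].
  have [z' zE] := eps_surj z; exists (x - a * z'), z'.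
  by rewrite subrK rmorphB rmorphM zE xE addrK.
by exists (eps y), (eps z); rewrite rmorphD rmorphM.
Qed.

(** [N'] is the extension of [N] to polynomials. Constants remain regular coefficient by
    coefficient, and a polynomial with invertible leading coefficient is regular modulo any extended
    ideal. *)
Lemma regular_seq_poly (R : comNzRingType) (N : R -> Prop) (N' : {poly R} -> Prop)
    s (g : {poly R}) u :
  is_ideal N -> (forall f, N' f <-> forall i, N f`_i) -> u * lead_coef g = 1 ->
  regular_seq N s -> regular_seq N' (rcons (map polyC s) g).
Proof.
elim: s N N' => [|a s IH] N N' iN NN' ug /=.
  move=> _; split=> // x /NN' Ngx; apply/NN'.
  have [N0 ND NM] := iN.
  suff H d i : (size x <= i + d)%N -> N x`_i by move=> i; apply: (H (size x)); lia.
  elim: d i => [|d IHd] i sx; first by rewrite nth_default // -[i]addn0.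
  have /(NM u) := Ngx ((size g).-1 + i)%N.
  have lt : ((size g).-1 < ((size g).-1 + i).+1)%N by lia.
  rewrite coefM (bigD1 (Ordinal lt)) //= addKn mulrDr -lead_coefE mulrA ug mul1r.
  set S := \sum_(_ < _ | _) _ => Ns.
  rewrite -(addrK (u * S) x`_i); apply: ideal_sub => //; apply: (NM u).
  apply: (big_ind N) => // -[j jlt] /=; rewrite -val_eqE /= => jne.
  have [jl|jl] := ltnP j (size g).-1; first apply: NM.
    by apply: IHd; move: (size g).-1 (size x) sx jl => p q; lia.
  by rewrite nth_default ?mul0r //; move: jne jl; rewrite leq_eqVlt eq_sym => /negPf ->; case: (size g).
case=> ra rs; split; first by move=> x /NN' Nx; apply/NN' => i; apply: ra; rewrite -coefCM.
apply: (IH _ _ (add_gen_ideal a iN)) => // f; split.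
  move=> [y [z [/NN' Ny ->]]] i; exists y`_i, z`_i.
  by rewrite coefD coefCM.
(* Decompositions of the single coefficients are assembled into one of the polynomial: adding a
   constant generator commutes with extending the ideal. *)
elim/poly_ind: f => [|p c IHp] h.
  by apply: add_gen_sub; apply/NN' => i; rewrite coef0; case: iN.
have [i|y [z [/NN' Ny ->]]] := IHp.
  by have := h i.+1; rewrite coefD coefMX coefC addr0.
have [y0 [z0 [Ny0]]] := h 0%N; rewrite coefD coefMX coefC add0r /= => ->.
exists (y * 'X + y0%:P), (z * 'X + z0%:P); split.
  by apply/NN' => -[|i]; rewrite coefD coefMX coefC ?add0r ?addr0.
by rewrite mulrDr mulrDl rmorphD rmorphM mulrA addrACA.
Qed.

(** * Bounds on partial degrees *)

Section Bounds.
Variable k : comNzRingType.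

(** All partial degrees are strictly below [B], matching the convention of [size]. The product
    bounds below are not sharp; linear growth in the exponents is enough for the counting. *)
Fixpoint mbound (B : nat) (n : nat) : mpoly k n -> Prop :=
  match n return mpoly k n -> Prop with
  | 0 => fun _ => True
  | n'.+1 => fun f : {poly mpoly k n'} => (size f <= B)%N /\ forall d, mbound B f`_d
  end.

Lemma mbound_leq B B' n (f : mpoly k n) : (B <= B')%N -> mbound B f -> mbound B' f.
Proof.
move=> BB'; elim: n f => [|n IH] f //= [sf bf]; split; first exact: leq_trans BB'.
by move=> d; exact: IH.
Qed.

Lemma mbound0 B n : mbound B (0 : mpoly k n).
Proof.
by elim: n => [|n IH] //=; rewrite size_poly0; split=> // d; rewrite coef0.
Qed.

Lemma mboundD B n (f g : mpoly k n) : mbound B f -> mbound B g -> mbound B (f + g).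
Proof.
elim: n f g => [|n IH] f g //= [sf bf] [sg bg]; split.
  by apply: leq_trans (size_polyD f g) _; rewrite geq_max sf.
by move=> d; rewrite coefD; apply: IH.
Qed.

Lemma mbound_sum B n I (r : seq I) (F : I -> mpoly k n) :
  (forall x, mbound B (F x)) -> mbound B (\sum_(x <- r) F x).
Proof.
move=> bF; apply: (big_ind (@mbound B n)) => //; first exact: mbound0.
exact: mboundD.
Qed.

Lemma mboundM B B' n (f g : mpoly k n) :
  mbound B f -> mbound B' g -> mbound (B + B') (f * g).
Proof.
elim: n f g => [|n IH] f g //= [sf bf] [sg bg]; split.
  apply: leq_trans (size_polyMleq f g) _; apply: leq_trans (leq_pred _) _.
  exact: leq_add.
by move=> d; rewrite coefM; apply: mbound_sum => j; apply: IH.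
Qed.

Lemma mboundC B n c : (0 < B)%N -> mbound B (mC n c : mpoly k n).
Proof.
move=> B0; elim: n => [|n IH] //=; split.
  by apply: leq_trans (size_polyC_leq1 _) _.
by move=> d; rewrite coefC; case: eqP => // _; exact: mbound0.
Qed.

Lemma mboundCM B n c (f : mpoly k n) : mbound B f -> mbound B (mC n c * f).
Proof.
elim: n f => [|n IH] f //= [sf bf]; split=> [|d]; last by rewrite coefCM; exact: IH.
by apply: leq_trans sf; rewrite mul_polyC; exact: size_scale_leq.
Qed.

Lemma mboundX B n (f : mpoly k n) u : mbound B f -> mbound (u * B).+1 (f ^+ u).
Proof.
move=> bf; elim: u => [|u IH]; first by rewrite expr0 -(rmorph1 (@mC k n)); exact: mboundC.
by rewrite exprS mulSn -addnS; exact: mboundM.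
Qed.

Lemma mbound_prod B n I (r : seq I) (F : I -> mpoly k n) :
  (forall x, mbound B (F x)) -> mbound (size r * B).+1 (\prod_(x <- r) F x).
Proof.
move=> bF; elim: r => [|x r IH].
  by rewrite big_nil -(rmorph1 (@mC k n)); exact: mboundC.
by rewrite big_cons /= mulSn -addnS; exact: mboundM.
Qed.

Lemma mbound_ex n (f : mpoly k n) : exists B, mbound B f.
Proof.
elim: n f => [|n IH] f; first by exists 0%N.
elim/poly_ind: f => [|p c [B bp]]; first by exists 0%N; exact: mbound0.
have [B' bc] := IH c; exists (maxn B B').+1; split=> [|d].
  rewrite size_MXaddC; case: ifP => // _; rewrite ltnS leq_max; by case: bp => ->.
rewrite coefD coefMX coefC; case: d => [|d] /=.
  by rewrite add0r; apply: mbound_leq bc; rewrite leqW // leq_maxr.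
have [_ bpd] := bp; rewrite addr0; apply: mbound_leq (bpd d).
by rewrite leqW // leq_maxl.
Qed.

Lemma mcoef_mbound B n (f : mpoly k n) u l :
  mbound B f -> (l < n)%N -> (B <= u l)%N -> mcoef u f = 0.
Proof.
elim: n f => [|n IH] f //= [sf bf]; rewrite ltnS leq_eqVlt => /orP [/eqP ->|ln] Bu.
  by rewrite nth_default ?raddf0 // (leq_trans sf).
exact: IH.
Qed.

End Bounds.

Definition ext_fun n B (s : {ffun 'I_n -> 'I_B}) : nat -> nat :=
  fun l => oapp (fun i => s i : nat) 0%N (insub l).

Lemma ext_funE n B (s : {ffun 'I_n -> 'I_B}) (i : 'I_n) : ext_fun s i = s i.
Proof. by rewrite /ext_fun insubT ?ltn_ord //= => lt; congr (s _ : nat); apply: val_inj. Qed.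

Arguments mC : simpl never.
Arguments mX : simpl never.
Arguments meval : simpl never.
Arguments mcoef : simpl never.

(** * Algebraic dependence, Nagata's trick and regular sequences in an ideal *)

Section AlgebraicDependence.
Variable k : fieldType.

Lemma exists_left_kernel p q (A : 'M[k]_(p, q)) : (q < p)%N ->
  exists2 c : 'rV_p, c != 0 & c *m A = 0.
Proof.
move=> qp; have : kermx A != 0.
  by rewrite -mxrank_eq0 mxrank_ker subn_eq0 -ltnNge (leq_ltn_trans (rank_leq_col A)).
by case/rowV0Pn => c /sub_kermxP cA c0; exists c.
Qed.

(** The products of powers of the [y l] with exponents below [D] outnumber the coefficients they can
    have, so a nontrivial combination of them vanishes. *)
Lemma alg_dependent rho (y : nat -> mpoly k rho) :
  exists2 F : mpoly k rho.+1, F != 0 & meval y F = 0.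
Proof.
have [E yE] : exists E, forall l, (l < rho.+1)%N -> mbound E (y l).
  elim: rho.+1 => [|n [E IH]]; first by exists 0%N.
  have [E' yE'] := mbound_ex (y n); exists (maxn E E') => l; rewrite ltnS leq_eqVlt.
  case/orP => [/eqP ->|/IH]; first by apply: mbound_leq yE'; exact: leq_maxr.
  by apply: mbound_leq; exact: leq_maxl.
(* A product of rho + 1 factors with exponents below [D] has partial degrees below D * E'. Taking D
   > E' ^ rho makes D ^ (rho + 1) products exceed the (D * E') ^ rho available monomials. *)
pose E' := (rho.+1 * (E + 1)).+1.
pose D := (E' ^ rho).+1.
pose B := (D * E')%N.
pose I1 := {ffun 'I_rho.+1 -> 'I_D}; pose I2 := {ffun 'I_rho -> 'I_B}.
pose Y (u : I1) := \prod_(l < rho.+1) y l ^+ u l.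
have bY u : mbound B (Y u).
  pose F (l : 'I_rho.+1) := y l ^+ u l.
  have bF l : mbound (D * E).+1 (F l).
    apply: mbound_leq (mboundX (u l) (yE l (ltn_ord l))).
    by rewrite ltnS leq_mul2r ltnW ?orbT.
  have := mbound_prod (index_enum 'I_rho.+1) bF.
  have -> : size (index_enum 'I_rho.+1) = rho.+1.
    by rewrite /index_enum -enumT size_enum_ord.
  apply: mbound_leq.
  by rewrite /B /E'; have : (0 < D)%N by []; nia.
pose M := \matrix_(i < #|{: I1}|, j < #|{: I2}|)
   mcoef (ext_fun (enum_val j)) (Y (enum_val i)).
have [|c c0 cM] := @exists_left_kernel _ _ M.
  rewrite !card_ffun !card_ord /B expnMn expnS mulnC ltn_mul2r.
  by rewrite expn_gt0 /= -/D /D ltnS leqnn.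
exists (\sum_i mC rho.+1 (c 0 i) * tmon k rho.+1 (ext_fun (enum_val i))).
  case/matrix0Pn: c0 => i0 [i]; rewrite (ord1 i0) => ci.
  apply: contraNneq ci => F0.
  have := congr1 (mcoef (ext_fun (enum_val i))) F0.
  rewrite raddf0 raddf_sum (bigD1 i) //= mcoefCM mcoef_tmon.
  have -> : [forall l : 'I_rho.+1, ext_fun (enum_val i) l == ext_fun (enum_val i) l].
    exact/forallP.
  rewrite mulr1 big1 ?addr0 => [->//|j ji].
  rewrite mcoefCM mcoef_tmon; case: forallP => [h|]; last by rewrite mulr0.
  case/eqP: ji; apply: enum_val_inj; apply/ffunP => l; apply/val_inj/eqP.
  by have := h l; rewrite !ext_funE.
apply: mcoef_eq0 => u.
have bF : mbound B (\sum_i mC rho (c 0 i) * Y (enum_val i)).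
  by apply: mbound_sum => i; exact: mboundCM.
have -> : meval y (\sum_i mC rho.+1 (c 0 i) * tmon k rho.+1 (ext_fun (enum_val i)))
  = \sum_i mC rho (c 0 i) * Y (enum_val i).
  rewrite rmorph_sum; apply: eq_bigr => i _; rewrite rmorphM /= meval_mC meval_tmon.
  by congr (_ * _); apply: eq_bigr => l _; rewrite ext_funE.
have [/existsP[l ul]|] := boolP [exists l : 'I_rho, (B <= u l)%N].
  exact: mcoef_mbound bF (ltn_ord l) ul.
rewrite negb_exists => /forallP uB.
have B0 : (0 < B)%N by [].
pose s : I2 := [ffun l : 'I_rho => insubd (Ordinal B0) (u l)].
rewrite (@eq_mcoef _ _ u (ext_fun s)); last first.
  move=> l lr; rewrite -[l]/(val (Ordinal lr)) ext_funE ffunE insubdK //.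
  by have := uB (Ordinal lr); rewrite -ltnNge.
rewrite raddf_sum /=.
have /matrixP/(_ 0 (enum_rank s)) := cM; rewrite !mxE => cM0; rewrite -[RHS]cM0.
by apply: eq_bigr => i _; rewrite mcoefCM !mxE enum_rankK.
Qed.

(* Nagata's change of variables: after x_l |-> x_l + X^(B^(l+1)) a polynomial with
   partial degrees < B becomes monic in X up to a constant, because distinct
   monomials get distinct X-degrees. *)
Lemma size_monic_exp (R : nzRingType) (p : {poly R}) d :
  p \is monic -> size (p ^+ d) = (d * (size p).-1).+1.
Proof.
move=> pm; elim: d => [|d IH]; first by rewrite expr0 size_poly1.
rewrite exprS size_monicM // -?size_poly_eq0 IH // addnS /= mulSn.
by rewrite -addSn prednK // lt0n size_poly_eq0 monic_neq0.
Qed.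

Section Nagata.
Variable N : nat.
Implicit Types p q : {poly mpoly k N}.

Definition const_lead p := exists2 c : k, c != 0 & lead_coef p = mC N c.

Lemma const_lead_neq0 p : const_lead p -> p != 0.
Proof.
case=> c c0 pc; rewrite -lead_coef_eq0 pc; apply: contraNneq c0 => c0.
by apply/eqP/(@mC_inj k N); rewrite c0 rmorph0.
Qed.

Lemma const_leadD p q : const_lead p -> const_lead q -> size p != size q ->
  const_lead (p + q) /\ size (p + q) = maxn (size p) (size q).
Proof.
move=> cp cq; rewrite neq_ltn => /orP [] lt.
  rewrite addrC size_polyDl // (maxn_idPr (ltnW lt)); split=> //.
  by rewrite /const_lead lead_coefDl.
rewrite size_polyDl // (maxn_idPl (ltnW lt)); split=> //.
by rewrite /const_lead lead_coefDl.
Qed.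

(** Summands of different degrees cannot cancel at the top. Zero summands are allowed since
    coefficients of the polynomial to be transformed may vanish. *)
Lemma const_lead_sum n (F : nat -> {poly mpoly k N}) :
  (forall d, (d < n)%N -> F d = 0 \/ const_lead (F d)) ->
  (forall d d', (d < n)%N -> (d' < n)%N -> d != d' -> F d != 0 -> F d' != 0 ->
     size (F d) != size (F d')) ->
  (forall d, (d < n)%N -> F d = 0) \/
  exists d, [/\ (d < n)%N, F d != 0, const_lead (\sum_(d < n) F d) &
     size (\sum_(d < n) F d) = size (F d)].
Proof.
elim: n => [|n IH] F0 Fs; first by left.
have {IH} [d dn|d d' dn d'n|all0|[d [dn Fd cS sS]]] := IH.
- by apply: F0; rewrite ltnW.
- by apply: Fs; rewrite ltnW.
- have S0 : \sum_(d < n) F d = 0 by apply: big1 => d _; exact: all0.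
  have [Fn|cn] := F0 n (ltnSn n).
    by left=> d; rewrite ltnS leq_eqVlt => /orP [/eqP ->|/all0].
  by right; exists n; rewrite big_ord_recr /= S0 add0r; split=> //; exact: const_lead_neq0.
- right; rewrite big_ord_recr /=; have [->|cn] := F0 n (ltnSn n).
    by exists d; rewrite addr0; split=> //; rewrite ltnW.
  have Fn := const_lead_neq0 cn.
  have ne : size (F d) != size (F n).
    by apply: Fs => //; [rewrite ltnW | rewrite (ltn_eqF dn)].
  have [|cD ->] := const_leadD cS cn; first by rewrite sS.
  rewrite sS; have [le|le] := leqP (size (F d)) (size (F n)).
    by exists n.
  by exists d; split=> //; rewrite ltnW.
Qed.

Variable B : nat.

Definition nagata (l : nat) : mpoly k N.+1 :=
  ('X^(B ^ l.+1) + (mX k N l)%:P : {poly mpoly k N}).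

(** The exponents of a monomial are the base-[B] digits of [e]. The extra factor [B] leaves the
    lowest digit free for the last variable, which [nagata_aut] fixes. *)
Lemma nagata_lead n (f : mpoly k n) : (n <= N)%N -> mbound B f -> f != 0 ->
  const_lead (meval nagata f) /\
  exists2 e, (e < B ^ n)%N & size (meval nagata f : {poly mpoly k N}) = (B * e).+1.
Proof.
elim: n f => [|n IH] f nN.
  move=> _ f0; split; first by exists f => //; exact: lead_coefC.
  exists 0%N; rewrite ?expn0 // muln0.
  by rewrite [LHS](_ : _ = size (mC N f)%:P) // size_polyC -(rmorph0 (mC N)) (inj_eq (@mC_inj k N)) f0.
move=> [/= sf bf] f0; have B0 : (0 < B)%N.
  by rewrite (leq_trans _ sf) // lt0n size_poly_eq0.
have {}IH d := IH f`_d (ltnW nN) (bf d).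
pose Z : {poly mpoly k N} := nagata n.
have Zm : Z \is monic.
  by rewrite monicE lead_coefDl ?lead_coefXn // size_polyXn (leq_ltn_trans (size_polyC_leq1 _)) // ltnS expn_gt0 B0.
have sZ : size Z = (B ^ n.+1).+1.
  by rewrite size_polyDl ?size_polyXn // (leq_ltn_trans (size_polyC_leq1 _)) // ltnS expn_gt0 B0.
pose F d : {poly mpoly k N} := (meval nagata (f`_d) : {poly mpoly k N}) * Z ^+ d.
have sF d : f`_d != 0 -> exists2 e, (e < B ^ n)%N & size (F d) = (B * (e + d * B ^ n)).+1.
  move=> fd; have [_ [e eB es]] := IH d fd.
  exists e => //; rewrite size_Mmonic ?monic_exp //; last by rewrite -size_poly_eq0 es.
  by rewrite es size_monic_exp // sZ /= addnS /= mulnDr mulnCA -expnS.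
have F0 d : f`_d = 0 -> F d = 0 by move=> fd; rewrite /F fd rmorph0 mul0r.
have fE : meval nagata (f : mpoly k n.+1) = \sum_(d < size f) F d by [].
have [d _|d d' _ _ dd' Fd Fd'|all0|[d [ds Fd cF sFd]]] := @const_lead_sum (size f) F.
- have [/F0 ->|fd] := eqVneq f`_d 0; [by left|right].
  by rewrite /const_lead lead_coef_Mmonic ?monic_exp //; have [] := IH d fd.
- have fd : f`_d != 0 by apply: contraNneq Fd => /F0 ->.
  have fd' : f`_d' != 0 by apply: contraNneq Fd' => /F0 ->.
  have [e eB ->] := sF d fd; have [e' eB' ->] := sF d' fd'.
  apply: contra dd'; rewrite eqSS eqn_pmul2l // => /eqP e2.
  have Bn : (0 < B ^ n)%N by rewrite expn_gt0 B0.
  apply/eqP; have := congr1 (divn^~ (B ^ n)%N) e2.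
  by rewrite /= !(addnC e, addnC e') !divnMDl // !divn_small // !addn0.
- have lt : ((size f).-1 < size f)%N by rewrite prednK // lt0n size_poly_eq0.
  have [|e _] := sF (size f).-1; first by rewrite -lead_coefE lead_coef_eq0.
  by rewrite all0 // size_poly0.
- have fd : f`_d != 0 by apply: contraNneq Fd => /F0 ->.
  rewrite fE; split=> //; rewrite sFd; have [e eB ->] := sF d fd.
  exists (e + d * B ^ n)%N => //; rewrite expnS.
  have dB : (d.+1 * B ^ n <= B * B ^ n)%N by rewrite leq_mul2r (leq_trans ds sf) orbT.
  by apply: leq_trans dB; rewrite mulSn ltn_add2r.
Qed.

Definition nagata_aut (l : nat) : mpoly k N.+1 :=
  if (l < N)%N then nagata l else ('X : {poly mpoly k N}).

Definition nagata_inv (l : nat) : mpoly k N.+1 :=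
  if (l < N)%N then ((mX k N l)%:P - 'X^(B ^ l.+1) : {poly mpoly k N})
  else ('X : {poly mpoly k N}).

Lemma nagata_aut_lead (f : mpoly k N.+1) : mbound B f -> f != 0 ->
  const_lead (meval nagata_aut f).
Proof.
move: f => f [/= sf bf] f0.
pose F d : {poly mpoly k N} := (meval nagata (f`_d) : {poly mpoly k N}) * 'X^d.
have fE : meval nagata_aut (f : mpoly k N.+1) = \sum_(d < size f) F d.
  apply: eq_bigr => d _; rewrite /F /nagata_aut ltnn; congr (_ * _).
  by apply: eq_meval => l ->.
have IH d := @nagata_lead N f`_d (leqnn N) (bf d).
have F0 d : f`_d = 0 -> F d = 0 by move=> fd; rewrite /F fd rmorph0 mul0r.
have sF d : f`_d != 0 -> exists e, size (F d) = (B * e + d).+1.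
  move=> fd; have [cl [e eB es]] := IH d fd.
  exists e; rewrite size_Mmonic ?monicXn //; last by rewrite -size_poly_eq0 es.
  by rewrite es size_polyXn addnS.
have [d _|d d' ds ds' dd' Fd Fd'|all0|[d [ds Fd cF sFd]]] := @const_lead_sum (size f) F.
- have [/F0 ->|fd] := eqVneq f`_d 0; [by left|right].
  by rewrite /const_lead lead_coef_Mmonic ?monicXn //; have [] := IH d fd.
- have fd : f`_d != 0 by apply: contraNneq Fd => /F0 ->.
  have fd' : f`_d' != 0 by apply: contraNneq Fd' => /F0 ->.
  have [e ->] := sF d fd; have [e' ->] := sF d' fd'.
  apply: contra dd'; rewrite eqSS => /eqP e2.
  apply/eqP; have := congr1 (modn^~ B) e2.
  by rewrite /= !(mulnC B) !modnMDl !modn_small // (leq_trans _ sf).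
- have lt : ((size f).-1 < size f)%N by rewrite prednK // lt0n size_poly_eq0.
  have [|e] := sF (size f).-1; first by rewrite -lead_coefE lead_coef_eq0.
  by rewrite all0 // size_poly0.
- by rewrite fE.
Qed.

Lemma mXS l n : mX k n.+1 l =
  (if l == n then 'X else (mX k n l)%:P : {poly mpoly k n}).
Proof. by []. Qed.

Lemma nagata_autK : cancel (meval nagata_inv (n := N.+1)) (meval nagata_aut (n := N.+1)).
Proof.
move=> f; rewrite meval_comp -[RHS]meval_id; apply: eq_meval => l lN.
have vX : (meval nagata_aut (('X : {poly mpoly k N}) : mpoly k N.+1)) = ('X : {poly mpoly k N}).
  rewrite [X in meval _ X = _](_ : _ = mX k N.+1 N); last by rewrite mXS eqxx.
  by rewrite meval_mX // /nagata_aut ltnn.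
rewrite mXS /nagata_inv; move: lN; rewrite ltnS leq_eqVlt.
have [-> _|nlN /= lN] := eqVneq l N; first by rewrite ltnn vX.
rewrite lN rmorphB /= rmorphXn /= vX.
rewrite [(mX k N l)%:P](_ : _ = mX k N.+1 l); last by rewrite mXS (negPf nlN).
rewrite (meval_mX _ (leqW lN)) /nagata_aut lN.
have addKl (V : zmodType) (x y : V) : x + y - x = y by rewrite addrC addKr.
rewrite [RHS]mXS (negPf nlN); exact: addKl.
Qed.

Lemma nagata_invK : cancel (meval nagata_aut (n := N.+1)) (meval nagata_inv (n := N.+1)).
Proof.
move=> f; rewrite meval_comp -[RHS]meval_id; apply: eq_meval => l lN.
have vX : (meval nagata_inv (('X : {poly mpoly k N}) : mpoly k N.+1)) = ('X : {poly mpoly k N}).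
  rewrite [X in meval _ X = _](_ : _ = mX k N.+1 N); last by rewrite mXS eqxx.
  by rewrite meval_mX // /nagata_inv ltnn.
rewrite mXS /nagata_aut; move: lN; rewrite ltnS leq_eqVlt.
have [-> _|nlN /= lN] := eqVneq l N; first by rewrite ltnn vX.
rewrite lN rmorphD /= rmorphXn /= vX.
rewrite [(mX k N l)%:P](_ : _ = mX k N.+1 l); last by rewrite mXS (negPf nlN).
rewrite (meval_mX _ (leqW lN)) /nagata_inv lN.
have addKl (V : zmodType) (x y : V) : x + (y - x) = y by rewrite addrC subrK.
rewrite [RHS]mXS (negPf nlN); exact: addKl.
Qed.

End Nagata.

Lemma meval_polyC m n (y : nat -> mpoly k m) (f : mpoly k n) :
  (meval y f)%:P = meval (fun l => (y l)%:P : mpoly k m.+1) f.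
Proof.
elim/mpoly_ind_ring: f => [c|l ln|f g IHf IHg|f g IHf IHg].
- by rewrite !meval_mC.
- by rewrite !meval_mX.
- by rewrite [in LHS]rmorphD polyCD IHf IHg [in RHS]rmorphD.
- by rewrite [in LHS]rmorphM polyCM IHf IHg [in RHS]rmorphM.
Qed.

(* One variable is peeled off at a time: a nonzero element of K, made monic in the
   last variable, is regular modulo any ideal extended from the remaining ones. *)
Lemma noether_regular_seq rho N (K : mpoly k N -> Prop) : is_ideal K ->
  (forall y : nat -> mpoly k N, exists2 F : mpoly k rho, F != 0 & K (meval y F)) ->
  exists s, [/\ size s = (N.+1 - rho)%N, forall t, (t < size s)%N -> K s`_t &
                regular_seq (fun x => x = 0) s].
Proof.
(* Dependence of any [rho] elements modulo [K] says that the dimension is below [rho], so the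
   codimension is at least N + 1 - rho. *)
elim: N K => [|N IH] K iK Kdep.
  case: rho Kdep => [|rho] Kdep; last by exists [::].
  (* With no variables and [rho] zero, the relation is a nonzero constant in [K]: a unit, and the
     one element required. *)
  have [F F0 KF] := Kdep (fun=> 0).
  exists [:: (F : k)]; split=> //; first by case.
  split=> // x /eqP; rewrite [_ == _]mulf_eq0 (negPf F0) => /eqP //.
have [le|lt] := leqP rho N.+1; last first.
  by exists [::]; split=> //; apply/eqP; rewrite eq_sym subn_eq0.
have [F F0 KF] := Kdep (mX k N.+1).
set f := meval _ F in KF.
have f0 : f != 0.
  apply: contraNneq F0 => f0.
  have := congr1 (meval (mX k rho) (n := N.+1)) f0; rewrite rmorph0 => <-.
  rewrite meval_comp -[X in X == _]meval_id; apply/eqP/eq_meval => l lr.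
  by rewrite meval_mX // (leq_trans lr).
have [B bf] := mbound_ex f.
pose th := meval (nagata_aut N B) (n := N.+1).
pose th' := meval (nagata_inv N B) (n := N.+1).
have [c c0 thf] := nagata_aut_lead bf f0.
(* In the new coordinates, [K'] is the part of [K] free of the last variable. It inherits the
   dependence hypothesis with the same [rho]. *)
pose K' (g : mpoly k N) := K (th' (g%:P : {poly mpoly k N})).
have [K0 KD KM] := iK.
have iK' : is_ideal K'.
  rewrite /K'; split=> [|x y Kx Ky|x y Ky]; first by rewrite polyC0 [th' _]rmorph0.
    by rewrite polyCD [th' _]rmorphD; apply: KD.
  by rewrite polyCM [th' _]rmorphM; apply: KM.
have [y|s [ss sK rs]] := IH K' iK'.
  have [G G0 KG] := Kdep (fun l => th' ((y l)%:P : {poly mpoly k N})).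
  exists G => //; rewrite /K' meval_polyC /th' meval_comp //.
exists (map th' (rcons (map polyC s) (th f))); split.
- by rewrite size_map size_rcons size_map ss [RHS]subSn.
- move=> t; rewrite size_map size_rcons size_map => ts.
  rewrite (nth_map 0) ?size_rcons ?size_map // nth_rcons size_map.
  move: ts; rewrite ltnS leq_eqVlt => /orP [/eqP ->|ts].
    by rewrite ltnn eqxx [th' _]nagata_invK.
  by rewrite ts (nth_map 0) //; exact: sK.
have r1 : regular_seq (fun x : {poly mpoly k N} => x = 0) (rcons (map polyC s) (th f)).
  apply: (@regular_seq_poly _ (fun x => x = 0) _ s _ (mC N c^-1)) => //.
  - by split=> [//|_ _ -> ->|x _ ->]; rewrite ?addr0 ?mulr0.
  - move=> g; split=> [->|g0]; first by move=> i; rewrite coef0.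
    by apply/polyP => i; rewrite coef0 g0.
  - by rewrite thf -rmorphM mulVf // rmorph1.
have {}r1 : regular_seq (fun x : mpoly k N.+1 => x = 0)
    (map th (map th' (rcons (map polyC s) (th f)))).
  by rewrite (mapK (@nagata_autK N B)).
have th_surj y : exists x, th x = y by exists (th' y); exact: nagata_autK.
apply: eq_regular_seq (@regular_seq_lift _ _ th _ _ th_surj r1) => x.
split=> [thx|->]; last by rewrite rmorph0.
by rewrite -[x](@nagata_invK N B) (thx : meval (nagata_aut N B) x = 0) rmorph0.
Qed.

End AlgebraicDependence.

(** * Graded Nakayama *)

Section GradedNakayama.
Variables (k : fieldType) (n : nat) (w : nat -> nat).
Hypothesis w_gt0 : forall l, (l < n)%N -> (0 < w l)%N.
Notation P := (mpoly k n).

(** The outer variable T records weight: x_l goes to x_l T^(w l), and setting T = 1 recovers [f]. *)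
Definition grade : P -> {poly P} :=
  meval (fun l => (mX k n l)%:P * 'X^(w l) : mpoly k n.+1) (n := n).

HB.instance Definition _ := GRing.RMorphism.copy grade
  (meval (fun l => (mX k n l)%:P * 'X^(w l) : mpoly k n.+1) (n := n)).

Lemma grade_mC c : grade (mC n c) = (mC n c)%:P.
Proof. exact: (@meval_mC k n.+1 _ n c). Qed.

Lemma grade_mX l : (l < n)%N -> grade (mX k n l) = (mX k n l)%:P * 'X^(w l).
Proof. by move=> ln; rewrite /grade meval_mX. Qed.

Definition hcomp d (f : P) : P := (grade f)`_d.

Definition homog d (f : P) := grade f = f%:P * 'X^d.

Lemma hcompD d f g : hcomp d (f + g) = hcomp d f + hcomp d g.
Proof. by rewrite /hcomp rmorphD coefD. Qed.

Lemma hcomp_sum d I (r : seq I) (F : I -> P) :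
  hcomp d (\sum_(x <- r) F x) = \sum_(x <- r) hcomp d (F x).
Proof. by rewrite /hcomp rmorph_sum /= coef_sum. Qed.

Lemma hcompCM d c f : hcomp d (mC n c * f) = mC n c * hcomp d f.
Proof. by rewrite /hcomp rmorphM /= grade_mC coefCM. Qed.

Lemma hcompXM d l f : (l < n)%N -> hcomp d (mX k n l * f) =
  if (d < w l)%N then 0 else mX k n l * hcomp (d - w l) f.
Proof.
move=> ln; rewrite /hcomp rmorphM /= grade_mX // mulrAC coefMXn.
by case: ifP => // _; rewrite coefCM.
Qed.

Lemma hcomp_homog d e f : homog d f -> hcomp e f = if e == d then f else 0.
Proof.
rewrite /hcomp => ->; rewrite coefCM coefXn.
by case: eqP; rewrite ?mulr1 ?mulr0.
Qed.

Lemma homog0 d : homog d 0.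
Proof. by rewrite /homog !rmorph0 mul0r. Qed.

Lemma homogD d f g : homog d f -> homog d g -> homog d (f + g).
Proof. by rewrite /homog => hf hg; rewrite rmorphD /= hf hg polyCD mulrDl. Qed.

Lemma homogM d e f g : homog d f -> homog e g -> homog (d + e) (f * g).
Proof. by rewrite /homog => hf hg; rewrite rmorphM /= hf hg polyCM mulrACA exprD. Qed.

Lemma homog_hcomp d f : homog d (hcomp d f).
Proof.
elim/mpoly_ind_ring: f d => [c|l ln|f g hf hg|f g hf hg] d.
- rewrite /hcomp grade_mC coefC; case: eqP => [->|_]; last exact: homog0.
  by rewrite /homog grade_mC mulr1.
- rewrite /hcomp grade_mX // coefCM coefXn; case: eqP => [->|_].
    by rewrite mulr1 /homog grade_mX.
  by rewrite mulr0; exact: homog0.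
- by rewrite hcompD; exact: homogD.
- rewrite /hcomp rmorphM /= coefM.
  apply: (big_ind (homog d)) => [|x y|[j jd] _]; [exact: homog0|exact: homogD|].
  rewrite -[X in homog X](subnKC (_ : j <= d)%N) //.
  exact: homogM.
Qed.

Lemma sum_hcomp f : f = \sum_(d < size (grade f)) hcomp d f.
Proof.
have := horner_coef (grade f) 1.
under eq_bigr do rewrite expr1n mulr1.
move=> <-; move: f; apply: (@eq_rmorph_mpoly k n P idfun (horner_eval 1 \o grade)) => [c|l ln] /=.
  by rewrite grade_mC /horner_eval hornerC.
by rewrite grade_mX // /horner_eval hornerM hornerC hornerXn expr1n mulr1.
Qed.

Definition ev0 : P -> k := meval (fun _ => 0 : mpoly k 0) (n := n).

HB.instance Definition _ := GRing.RMorphism.copy ev0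
  (meval (fun _ => 0 : mpoly k 0) (n := n)).

Lemma ev0_mC c : ev0 (mC n c) = c.
Proof. exact: (@meval_mC k 0 _ n c). Qed.

Lemma ev0_mX l : (l < n)%N -> ev0 (mX k n l) = 0.
Proof. by move=> ln; rewrite /ev0 meval_mX. Qed.

Lemma ev0_decomp f :
  exists e : nat -> P, f = mC n (ev0 f) + \sum_(l < n) mX k n l * e l.
Proof.
elim/mpoly_ind_ring: f => [c|l ln|f g [e ef] [d dg]|f g [e ef] [d dg]].
- by exists (fun=> 0); rewrite ev0_mC big1 ?addr0 // => l _; rewrite mulr0.
- exists (fun j => (j == l)%:R); rewrite ev0_mX // rmorph0 add0r.
  rewrite (bigD1 (Ordinal ln)) //= eqxx mulr1 big1 ?addr0 // => j.
  by rewrite -val_eqE /= => /negPf ->; rewrite mulr0.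
- exists (fun l => e l + d l); rewrite {1}ef {1}dg !rmorphD /= addrACA; congr (_ + _).
  by rewrite -big_split; apply: eq_bigr => l _; rewrite mulrDr.
- exists (fun l => e l * g + mC n (ev0 f) * d l).
  rewrite {1}ef mulrDl {1}dg !rmorphM /= mulrDr -addrA; congr (_ + _).
  rewrite mulr_sumr mulr_suml -big_split; apply: eq_bigr => l _.
  by rewrite mulrDr [RHS]addrC mulrCA -[_ * _ * g]mulrA.
Qed.

Variable I : P -> Prop.
Hypothesis iI : is_ideal I.

Definition maxI (f : P) := exists2 h : nat -> P,
  (forall l, I (h l)) & f = \sum_(l < n) mX k n l * h l.

Lemma maxI_ideal : is_ideal maxI.
Proof.
have [I0 ID IM] := iI; split=> [|_ _ [h Ih ->] [g Ig ->]|x _ [h Ih ->]].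
- by exists (fun=> 0) => //; rewrite big1 // => l _; rewrite mulr0.
- exists (fun l => h l + g l); first by move=> l; apply: ID.
  by rewrite -big_split; apply: eq_bigr => l _; rewrite mulrDr.
- exists (fun l => x * h l); first by move=> l; apply: IM.
  by rewrite mulr_sumr; apply: eq_bigr => l _; rewrite mulrCA.
Qed.

Lemma maxI_mul q g : ev0 q = 0 -> I g -> maxI (q * g).
Proof.
have [_ _ IM] := iI.
have [e ->] := ev0_decomp q; rewrite rmorphD /= ev0_mC rmorph_sum big1.
  rewrite addr0 => -> Ig; rewrite rmorph0 add0r; exists (fun l => e l * g).
    by move=> l; apply: IM.
  by rewrite mulr_suml; apply: eq_bigr => l _; rewrite mulrA.
by move=> l _; rewrite rmorphM /= ev0_mX ?mul0r.
Qed.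

(** Linear independence over [k] of the classes of [G] in I / m I, with m generated by the
    variables. *)
Definition indep_mod (G : seq P) := forall c : nat -> k,
  maxI (\sum_(t < size G) mC n (c t) * G`_t) ->
  forall t, (t < size G)%N -> c t = 0.

(** If [G] were longer than [gs], the constant terms of the coefficients expressing [G] through [gs]
    would have a left kernel vector. The corresponding combination of [G] has coefficients without
    constant term, so it lies in [maxI]. *)
Lemma indep_mod_size G gs : (forall t, (t < size G)%N -> I G`_t) ->
  (forall f, I f <-> span_ideal gs f) -> indep_mod G -> (size G <= size gs)%N.
Proof.
move=> IG Igs indG; rewrite leqNgt; apply/negP => lt.
have [H HE] : exists H : 'I_(size G) -> nat -> P,
    forall t : 'I_(size G), G`_t = \sum_(l < size gs) H t l * gs`_l.
  apply: (@fin_all_exists 'I_(size G) (fun=> nat -> P)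
    (fun (t : 'I_(size G)) H => G`_t = \sum_(l < size gs) H l * gs`_l)) => t.
  by have /Igs [c ->] := IG t (ltn_ord t); exists c.
have [c c0 cM] := exists_left_kernel (\matrix_(t, l) ev0 (H t (l : 'I_(size gs)))) lt.
have [i0 [t ct]] := matrix0Pn _ c0; rewrite ord1 in ct.
pose c' l := if insub l is Some t then c 0 t else 0.
have c'E (t' : 'I_(size G)) : c' t' = c 0 t'.
  by rewrite /c' insubT //= => lt'; congr (c _ _); exact: val_inj.
case/eqP: ct; rewrite -c'E; apply: indG => //.
under eq_bigr => t' _ do rewrite c'E HE mulr_sumr.
rewrite exchange_big; apply: ideal_sum => [|l]; first exact: maxI_ideal.
under eq_bigr => t' _ do rewrite mulrA.
rewrite -mulr_suml; apply: maxI_mul; last first.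
  by apply/Igs; exact: span_ideal_nth.
rewrite rmorph_sum; have /matrixP/(_ 0 l) := cM; rewrite !mxE => e; rewrite -[RHS]e.
by apply: eq_bigr => t' _; rewrite rmorphM /= ev0_mC mxE.
Qed.

Lemma sum_rcons (G : seq P) f (c : nat -> k) :
  \sum_(t < size (rcons G f)) mC n (c t) * (rcons G f)`_t =
  \sum_(t < size G) mC n (c t) * G`_t + mC n (c (size G)) * f.
Proof.
rewrite size_rcons big_ord_recr /= nth_rcons ltnn eqxx; congr (_ + _).
by apply: eq_bigr => t _; rewrite nth_rcons ltn_ord.
Qed.

(** Exchange argument: a given independent homogeneous family is enlarged until no homogeneous
    element of [I] is independent of it modulo [maxI]. *)
Lemma indep_mod_extend h G :
  (forall G', (forall t, (t < size G')%N -> I G'`_t) -> indep_mod G' -> (size G' <= h)%N) ->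
  (forall g, g \in G -> I g /\ exists d, homog d g) -> indep_mod G ->
  exists G', [/\ forall g, g \in G ++ G' -> I g /\ exists d, homog d g,
    indep_mod (G ++ G') &
    forall f d, I f -> homog d f -> exists c : nat -> k,
      maxI (f - \sum_(t < size (G ++ G')) mC n (c t) * (G ++ G')`_t)].
Proof.
move=> bound; have : (h < size G + h.+1)%N by rewrite addnS ltnS leq_addl.
(* The counter is the room left below the bound [h]; when it is used up, [G] is already too long. *)
elim: {2}h.+1 G => [|N IH] G sG hG indG.
  by have := bound G (fun t ts => (hG _ (mem_nth 0 ts)).1) indG; rewrite leqNgt -(addn0 (size G)) sG.
have [[f [d [If hf indf]]]|max] :=
  classic (exists f d, [/\ I f, homog d f & indep_mod (rcons G f)]).
  have [||//|G' [hG' indG' spG']] := IH (rcons G f); first by rewrite size_rcons addSnnS.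
    by move=> g; rewrite mem_rcons inE => /orP [/eqP ->|/hG //]; split=> //; exists d.
  by exists (f :: G'); rewrite -cat_rcons.
exists [::]; rewrite cats0; split=> // f d If hf.
have /not_all_ex_not [c] : ~ indep_mod (rcons G f) by move=> indf; case: max; exists f, d.
move=> nc; have [Mc nc'] := imply_to_and _ _ nc.
rewrite sum_rcons in Mc.
have cf0 : c (size G) != 0.
  apply/negP => /eqP cf0; case: nc' => t; rewrite size_rcons ltnS leq_eqVlt.
  case/orP => [/eqP -> //|]; apply: indG.
  by move: Mc; rewrite cf0 rmorph0 mul0r addr0.
exists (fun t => - (c t / c (size G))).
have [_ _ MM] := maxI_ideal.
have := MM (mC n (c (size G))^-1) _ Mc.
rewrite mulrDr mulrA -rmorphM mulVf // rmorph1 mul1r addrC; congr (maxI (_ + _)).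
rewrite mulr_sumr -sumrN; apply: eq_bigr => t _.
by rewrite rmorphN mulNr opprK mulrA -rmorphM [_^-1 * _]mulrC.
Qed.

(** Induction on the weight: an error term in [maxI] is a sum of x_l times elements of [I], whose
    relevant components have strictly smaller weight because all weights are positive. *)
Lemma graded_nakayama G :
  (forall f d, I f -> I (hcomp d f)) -> (forall g, g \in G -> I g /\ exists d, homog d g) ->
  (forall f d, I f -> homog d f -> exists c : nat -> k,
     maxI (f - \sum_(t < size G) mC n (c t) * G`_t)) ->
  forall f, I f <-> span_ideal G f.
Proof.
move=> Icomp hG spG f; split; last first.
  apply: span_ideal_min => // t ts; have [] // := hG _ (mem_nth 0 ts).
have [S0 SD SM] := span_ideal_is_ideal G.
suff hom d : forall f, I f -> homog d f -> span_ideal G f.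
  move=> If; rewrite [f]sum_hcomp; apply: ideal_sum => [|d].
    exact: span_ideal_is_ideal.
  by apply: (hom d); [exact: Icomp | exact: homog_hcomp].
elim/ltn_ind: d => d IH {}f If hf.
have [c [h Ih fE]] := spG f d If hf.
have {}fE : f = \sum_(t < size G) mC n (c t) * G`_t + \sum_(l < n) mX k n l * h l.
  by rewrite -fE addrC subrK.
have <- : hcomp d f = f by rewrite (hcomp_homog _ hf) eqxx.
rewrite fE hcompD !hcomp_sum; apply: (SD).
  apply: (big_ind (span_ideal G)) => // t _; rewrite hcompCM; apply: (SM).
  have [_ [e he]] := hG _ (mem_nth 0 (ltn_ord t)).
  by rewrite (hcomp_homog _ he); case: eqP => // _; exact: span_ideal_nth.
apply: (big_ind (span_ideal G)) => // l _; rewrite hcompXM //.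
case: ltnP => // wd; apply: SM; apply: (IH (d - w l)%N).
- by have := w_gt0 (ltn_ord l); lia.
- exact: Icomp.
- exact: homog_hcomp.
Qed.

End GradedNakayama.

(** * Toric ideals *)

Lemma tmon_neq0 (k : fieldType) m a : tmon k m a != 0.
Proof.
apply/eqP => t0; have := congr1 (mcoef a) t0; rewrite raddf0 mcoef_tmon.
have -> : [forall l : 'I_m, a l == a l] by exact/forallP.
by apply/eqP; exact: oner_neq0.
Qed.

Lemma allPn_type T (p : pred T) s : ~~ all p s -> exists x, ~~ p x.
Proof. by elim: s => [|x s IH] //=; rewrite negb_and => /orP [px|/IH]; first by exists x. Qed.

Lemma eq_big_all (R : nzSemiRingType) T (p q : pred T) (F : T -> R) s :
  all (fun x => p x == q x) s ->
  \sum_(x <- s) F x * (p x)%:R = \sum_(x <- s) F x * (q x)%:R.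
Proof.
elim: s => [|x s IH] /=; first by rewrite !big_nil.
by case/andP => /eqP pq /IH; rewrite !big_cons pq => ->.
Qed.

Lemma mcoef_toric (k : comNzRingType) n m a L (s : nat -> nat) :
  mcoef s (meval (fun r => tmon k m (a r))
    (\sum_(x <- L) mC n x.1 * tmon k n x.2)) =
  \sum_(x <- L) x.1 * [forall l : 'I_m, mdeg n a x.2 l == s l]%:R.
Proof.
rewrite !raddf_sum; apply: eq_bigr => x _.
by rewrite /= rmorphM /= meval_mC meval_tmon_tmon mcoefCM mcoef_tmon.
Qed.

Section ToricIdeals.
Variables (k : fieldType) (n m : nat) (a : nat -> nat -> nat).
Notation I := (toric_ideal k n m a).

Lemma toric_is_ideal : is_ideal I.
Proof.
rewrite /toric_ideal; split=> [|x y Ix Iy|x y Iy]; first by rewrite rmorph0.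
  by rewrite rmorphD /= Ix Iy addr0.
by rewrite rmorphM /= Iy mulr0.
Qed.

Lemma toric_ideal_prime f g : I (f * g) -> I f \/ I g.
Proof. by rewrite /toric_ideal rmorphM => /mpoly_mul_eq0. Qed.

Lemma toric_ideal_mXn r d f : (r < n)%N -> I (mX k n r ^+ d * f) -> I f.
Proof.
move=> rn /toric_ideal_prime [|//].
rewrite {1}/toric_ideal rmorphXn /= meval_mX // -tmonMn => t0.
by have := tmon_neq0 k m (fun l => d * a r l)%N; rewrite t0 eqxx.
Qed.

(** When x_l has the total degree of a_l as weight, the parametrisation respects gradings, so its
    kernel is graded. *)
Lemma toric_hcomp f d : I f ->
  I (hcomp (fun l => \sum_(t < m) a l t)%N d f).
Proof.
set w := fun l => _; move=> If.
suff E g : map_poly (meval (fun r => tmon k m (a r)) (n := n)) (grade w g) =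
           grade (fun=> 1%N) (meval (fun r => tmon k m (a r)) g).
  by rewrite /toric_ideal /hcomp -coef_map E If rmorph0 coef0.
elim/mpoly_ind_ring: g => [c|l ln|g h eg eh|g h eg eh].
- by rewrite grade_mC map_polyC /= !meval_mC grade_mC.
- rewrite grade_mX // rmorphM /= map_polyC map_polyXn /= meval_mX //.
  suff : homog (fun=> 1%N) (w l) (tmon k m (a l)) by move->.
  rewrite /tmon /w; elim/big_rec2: _ => [|t f' d' _ IH].
    by rewrite /homog -(rmorph1 (@mC k m)) grade_mC mulr1.
  apply: homogM => //; elim: (a l t) => [|e IHe].
    by rewrite /homog expr0 -(rmorph1 (@mC k m)) grade_mC mulr1.
  by rewrite exprS -[e.+1]/(1 + e)%N; apply: homogM => //; rewrite /homog grade_mX.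
- by rewrite !rmorphD /= eg eh.
- by rewrite !rmorphM /= eg eh.
Qed.

(** Restriction to a coordinate axis: it detects exactly the pure powers of x_r, which is how
    multiples of a_r are read off from elements of the ideal. *)
Definition axis r : mpoly k n -> {poly k} :=
  meval (fun l => if l == r then mX k 1 0 else 0) (n := n).

HB.instance Definition _ r := GRing.RMorphism.copy (axis r)
  (meval (fun l => if l == r then mX k 1 0 else 0) (n := n)).

Lemma axis_mC r c : axis r (mC n c) = c%:P.
Proof. exact: (@meval_mC k 1 _ n c). Qed.

Lemma axis_mX r l : (l < n)%N -> axis r (mX k n l) = if l == r then 'X else 0.
Proof. by move=> ln; rewrite /axis meval_mX. Qed.

Lemma axis_tmon r u : (r < n)%N -> axis r (tmon k n u) =
  if [forall l : 'I_n, (l != r :> nat) ==> (u l == 0%N)] then 'X^(u r) else 0.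
Proof.
move=> rn; rewrite /axis meval_tmon (bigD1 (Ordinal rn)) //= eqxx.
case: forallP => [h|/forallP].
  rewrite big1 ?mulr1 // => l; rewrite -val_eqE /= => lr.
  by have /implyP/(_ lr)/eqP -> := h l.
rewrite negb_forall => /existsP [l]; rewrite negb_imply => /andP [lr ul].
rewrite (bigD1 l) -?val_eqE //= (negPf lr) expr0n (negPf ul) mul0r.
exact: mulr0.
Qed.

Lemma coef_axis L r b : (r < n)%N ->
  (axis r (\sum_(x <- L) mC n x.1 * tmon k n x.2))`_b =
  \sum_(x <- L) x.1 * [forall l : 'I_n, x.2 l == if l == r :> nat then b else 0%N]%:R.
Proof.
move=> rn; rewrite rmorph_sum coef_sum; apply: eq_bigr => x _.
rewrite rmorphM /= axis_mC axis_tmon // coefCM; congr (_ * _).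
case: (forallP (P := fun l : 'I_n => (l != r :> nat) ==> (x.2 l == 0%N))) => h.
  rewrite coefXn; congr (_%:R : k); congr nat_of_bool.
  apply/eqP/forallP => [-> l|h'].
    by case: (l =P r :> nat) => [->|/eqP lr] //; have /implyP/(_ lr) := h l.
  by have := h' (Ordinal rn); rewrite /= eqxx => /eqP.
rewrite coef0; case: forallP => // h'; case: h => l; apply/implyP => lr.
by have := h' l; rewrite (negPf lr).
Qed.

(* If x_r^b occurs in f, another monomial of f has the same image; cancelling x_r
   from it leaves a multiple of a_r in the semigroup of the other vectors. *)
Lemma toric_axis r b f : (forall s, (s < n)%N -> nonzero_vec m (a s)) ->
  (r < n)%N -> I f -> (axis r f)`_b != 0 ->
  exists b', [/\ (0 < b')%N, (b' <= b)%N &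
    in_semigroup_except n m a r (fun l => b' * a r l)%N].
Proof.
move=> nz rn; have [L ->] := mpoly_expand f => If; rewrite coef_axis // => cb.
have := mcoef_toric n m a L (fun l => b * a r l)%N; rewrite If raddf0 => /esym sum0.
pose P1 (u : nat -> nat) := [forall l : 'I_m, mdeg n a u l == (b * a r l)%N].
pose Q (u : nat -> nat) := [forall l : 'I_n, u l == if l == r :> nat then b else 0%N].
(* If x_r^b were the only exponent in [L] with its image, its nonzero coefficient would equal the
   vanishing coefficient of the image. *)
have [PQ|] := boolP (all (fun x : k * (nat -> nat) => P1 x.2 == Q x.2) L).
  by case/eqP: cb; rewrite -[RHS]sum0; exact/esym/eq_big_all.
move=> /allPn_type [[c u] /= PQ].
have mdegr l : mdeg n a u l =
    (u r * a r l + \sum_(t < n | t != r :> nat) u t * a t l)%N.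
  by rewrite /mdeg (bigD1 (Ordinal rn)).
have QP : Q u -> P1 u.
  move=> /forallP Qu; apply/forallP => l; rewrite mdegr.
  have /eqP := Qu (Ordinal rn); rewrite /= eqxx => ->.
  rewrite big1 ?addn0 // => t tr.
  by have /eqP := Qu t; rewrite (negPf tr) => ->.
have [Pu nQu] : P1 u /\ ~~ Q u.
  by move: PQ QP; case: (P1 u); case: (Q u) => //= _ /(_ isT).
have {}Pu l : (l < m)%N ->
    (u r * a r l + \sum_(t < n | t != r :> nat) u t * a t l = b * a r l)%N.
  by move=> lm; have /eqP <- := forallP Pu (Ordinal lm); rewrite mdegr.
(* An exponent of x_r at least [b] leaves no room for other variables, as all vectors are nonzero;
   then [u] would be x_r^b itself. *)
have [bu|ub] := leqP b (u r).
  case/negP: nQu; have ur0 : u r = b.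
    have [l0 [l0m al0]] := nz r rn; have := Pu l0 l0m; nia.
  apply/forallP => t; case: (t =P r :> nat) => [->|/eqP tr]; first by rewrite ur0.
  have [l0 [l0m al0]] := nz t (ltn_ord t); have := Pu l0 l0m.
  by rewrite (bigD1 t) //= ur0; nia.
exists (b - u r)%N; split; [by rewrite subn_gt0|exact: leq_subr|].
by exists u => l lm; have := Pu l lm; rewrite mulnBl => <-; rewrite addKn.
Qed.

Lemma ev0_toric f : (forall s, (s < n)%N -> nonzero_vec m (a s)) -> I f -> ev0 f = 0.
Proof.
move=> nz If.
have <- : ev0 (meval (fun r => tmon k m (a r)) f) = ev0 f.
  rewrite {1}/ev0 meval_comp.
  apply: (@eq_meval k 0 (fun r => meval (fun=> 0 : mpoly k 0) (tmon k m (a r)))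
    (fun=> 0) n) => r rn.
  have [l [lm /eqP al]] := nz r rn.
  by rewrite meval_tmon (bigD1 (Ordinal lm)) //= expr0n (negPf al) mul0r.
by rewrite If rmorph0.
Qed.

(** A maximal set of independent columns of the matrix spans the others, so a difference of
    exponents killed by these columns is killed by all. *)
Lemma rank_columns : exists sg : nat -> nat,
  (forall j, (j < rkA n m a)%N -> (sg j < m)%N) /\
  forall u v, (forall j, (j < rkA n m a)%N -> mdeg n a u (sg j) = mdeg n a v (sg j)) ->
  forall l, (l < m)%N -> mdeg n a u l = mdeg n a v l.
Proof.
pose M : 'M[rat]_(n, m) := \matrix_(i < n, l < m) (a i l)%:R.
have rk : rkA n m a = \rank M^T by rewrite mxrank_tr.
rewrite rk; pose f := maxrankfun M^T.
pose sg j := if insub j is Some i then val (f i) else 0%N.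
have sgE (i : 'I_(\rank M^T)) : sg i = f i.
  by rewrite /sg insubT //= => lt; congr (f _ : nat); exact: val_inj.
exists sg; split=> [j jr|u v uv l lm].
  by rewrite -[j]/(val (Ordinal jr)) sgE; exact: ltn_ord.
have /submxP [X MX] : (M^T <= rowsub f M^T)%MS by rewrite eq_maxrowsub.
pose d : 'rV[rat]_n := \row_t ((u t)%:R - (v t)%:R).
have dM (l' : 'I_m) : (d *m M) 0 l' = (mdeg n a u l')%:R - (mdeg n a v l')%:R.
  rewrite mxE /mdeg !natr_sum -sumrB; apply: eq_bigr => t _.
  by rewrite !mxE mulrBl !natrM.
have d0 : d *m M = 0.
  have -> : M = (rowsub f M^T)^T *m X^T by rewrite -trmx_mul -MX trmxK.
  rewrite mulmxA [d *m _](_ : _ = 0) ?mul0mx //.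
  apply/rowP => j; have := dM (f j); rewrite -sgE uv // subrr => e.
  rewrite [RHS]mxE -[RHS]e !mxE; apply: eq_bigr => t _; by rewrite !mxE.
apply/eqP; rewrite -(Num.Theory.eqr_nat rat) -subr_eq0.
by have := dM (Ordinal lm); rewrite d0 mxE /= => <-.
Qed.

(** Forgetting the other coordinates merges no two image monomials, so the same sums of coefficients
    have to vanish. *)
Lemma toric_columns r sg : (forall j, (j < r)%N -> (sg j < m)%N) ->
  (forall u v, (forall j, (j < r)%N -> mdeg n a u (sg j) = mdeg n a v (sg j)) ->
   forall l, (l < m)%N -> mdeg n a u l = mdeg n a v l) ->
  forall f, toric_ideal k n r (fun s j => a s (sg j)) f -> I f.
Proof.
move=> sgm sgP f; have [L ->] := mpoly_expand f => If; apply: mcoef_eq0 => s.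
rewrite mcoef_toric.
pose hit (x : k * (nat -> nat)) := [forall l : 'I_m, mdeg n a x.2 l == s l].
have [no|] := boolP (all (fun x => hit x == false) L).
  by rewrite (eq_big_all _ no) big1 // => x _; rewrite mulr0.
case/allPn_type => -[c u]; rewrite eqbF_neg negbK => /forallP /= us.
have := congr1 (mcoef (fun j => mdeg n a u (sg j))) If.
rewrite raddf0 mcoef_toric => sum0; rewrite -[RHS]sum0.
apply: eq_bigr => x _; congr (_ * _%:R); congr nat_of_bool.
apply/forallP/forallP => [h j|h l]; apply/eqP.
  have jm := sgm j (ltn_ord j).
  by rewrite (eqP (us (Ordinal jm))); exact: (eqP (h (Ordinal jm))).
rewrite -(eqP (us l)); apply: sgP => // j jr.
exact: (eqP (h (Ordinal jr))).
Qed.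

Lemma toric_dependent (y : nat -> mpoly k n) :
  exists2 F : mpoly k (rkA n m a).+1, F != 0 & I (meval y F).
Proof.
have [sg [sgm sgP]] := rank_columns.
have [F F0 yF] := alg_dependent (fun l =>
  meval (fun s => tmon k (rkA n m a) (fun j => a s (sg j))) (y l)).
exists F => //; apply: (toric_columns sgm sgP).
by rewrite /toric_ideal meval_comp.
Qed.

(** Cutting by x_r lowers the number of independent elements by one: x_r joins the family [y], and
    the relation is read modulo x_r. *)
Lemma toric_dependent_mod (y : nat -> mpoly k n) r : (r < n)%N ->
  exists2 F : mpoly k (rkA n m a), F != 0 &
  exists h, I (meval y F + mX k n r * h).
Proof.
move=> rn; set rho := rkA n m a.
pose Y l := if (l < rho)%N then y l else mX k n r.
have [F F0 IF] := toric_dependent Y.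
(* The largest power of the last variable is split off, so that the constant coefficient [c] is
   nonzero; x_r^d is then cancelled modulo the prime ideal. *)
have [d [c [q [c0 FE]]]] : exists d (c : mpoly k rho) (q : {poly mpoly k rho}),
    c != 0 /\ F = (q * 'X + c%:P) * 'X^d.
  move: F F0 {IF}; elim/poly_ind => [|p c IH]; first by rewrite eqxx.
  have [->|c0] := eqVneq c 0; last by exists 0%N, c, p; rewrite mulr1.
  rewrite addr0 => pX; have [|d [c' [q [c'0 pE]]]] := IH.
    by apply: contraNneq pX => ->; rewrite mul0r.
  by exists d.+1, c', q; rewrite exprSr mulrA -pE.
have Yr : Y (rkA n m a) = mX k n r by rewrite /Y ltnn.
exists c => //; exists (meval Y (n := rho.+1) q).
apply: (@toric_ideal_mXn r d) => //; move: IF; rewrite FE.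
congr (toric_ideal _ _ _ _ _); rewrite mevalS rmorphM /= map_polyXn hornerM hornerXn.
rewrite Yr mulrC; congr (_ * _).
rewrite rmorphD rmorphM /= map_polyX map_polyC hornerD hornerM hornerX hornerC.
rewrite [in RHS]mevalS Yr mulrC addrC; congr (_ + _).
by apply: eq_meval => l lr; rewrite /Y lr.
Qed.

End ToricIdeals.

(** * Contraction of two proportional vectors *)

Lemma coprime_frobenius p q : (0 < p)%N -> (0 < q)%N -> coprime p q ->
  exists N, forall d, (N <= d)%N -> exists u v, d = (u * p + v * q)%N.
Proof.
move=> p0 q0 /eqP pq; case: (egcdnP q p0) => x y; rewrite pq => xy _.
(* From x p = y q + 1, the remainder r equals r x p - r y q. The bound makes the quotient t at least
   q y, hence at least r y. *)
exists (q * q * y + q)%N => d dN; set r := (d %% q)%N; set t := (d %/ q)%N.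
have rq : (r < q)%N by rewrite ltn_mod.
have dE : d = (t * q + r)%N by rewrite -divn_eq.
exists (r * x)%N, (t - r * y)%N.
have ty : (r * y <= t)%N.
  have : (q * q * y < t.+1 * q)%N by rewrite mulSn; lia.
  rewrite -mulnA [(q * _)%N]mulnC ltn_mul2r q0 ltnS => h.
  by apply: leq_trans h; rewrite leq_mul2r ltnW ?orbT.
rewrite -mulnA xy mulnBl -mulnA; nia.
Qed.

Lemma exists_preimage_seq (S T : eqType) (f : S -> T) (Q : S -> Prop) (r : seq T) :
  (forall y, y \in r -> exists2 x, Q x & f x = y) ->
  exists2 r', map f r' = r & forall x, x \in r' -> Q x.
Proof.
elim: r => [|y r IH] h; first by exists [::].
have [|r' rE Qr] := IH; first by move=> z zr; apply: h; rewrite inE zr orbT.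
have [x Qx xy] := h y (mem_head _ _); exists (x :: r'); first by rewrite /= rE xy.
by move=> z; rewrite inE => /orP [/eqP ->|/Qr].
Qed.

Lemma span_ideal_map (R S : comNzRingType) (f : {rmorphism R -> S}) gs x :
  span_ideal gs x -> span_ideal (map f gs) (f x).
Proof.
case=> c ->; exists (f \o c); rewrite size_map rmorph_sum; apply: eq_bigr => t _.
by rewrite rmorphM (nth_map 0).
Qed.

Lemma coef_sumM_neq0 (R : nzRingType) N (u v : nat -> {poly R}) b :
  (\sum_(t < N) u t * v t)`_b != 0 ->
  exists t d, [/\ (t < N)%N, (d <= b)%N & (v t)`_d != 0].
Proof.
move=> nz; apply: NNPP => h; case/eqP: nz.
rewrite coef_sum big1 // => t _; rewrite coefM big1 // => d _.
have [->|vt] := eqVneq (v t)`_(b - d) 0; first by rewrite mulr0.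
by case: h; exists t, (b - d)%N; split=> //; exact: leq_subr.
Qed.

Section Contraction.
Variables (k : fieldType) (n m : nat) (a : nat -> nat -> nat) (i j p q : nat).
Hypothesis nz : forall r, (r < n)%N -> nonzero_vec m (a r).
Hypotheses (ij : (i < j)%N) (jn : (j < n)%N) (p_gt0 : (0 < p)%N) (q_gt0 : (0 < q)%N).
Hypothesis pq : coprime p q.
Let e := gcdv (a i) (a j).
Hypothesis aiE : forall l, (l < m)%N -> a i l = (p * e l)%N.
Hypothesis ajE : forall l, (l < m)%N -> a j l = (q * e l)%N.
Notation a' := (contractA a i j).

Let lt_in : (i < n)%N. Proof. exact: ltn_trans jn. Qed.
Let lt_in1 : (i < n.-1)%N. Proof. by lia. Qed.

(** Deleting index [j] is reindexing by [bump j], with [unbump j] as inverse away from [j]. *)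
Lemma contractA_bump r : r != i -> a' r = a (bump j r).
Proof. by move=> /negPf ri; rewrite /contractA ri /bump; case: ltnP. Qed.

Lemma contractA_i : a' i = e.
Proof. by rewrite /contractA eqxx. Qed.

Lemma bump_lt r : (r < n.-1)%N -> (bump j r < n)%N.
Proof. by rewrite /bump; case: leqP => /=; lia. Qed.

Lemma bump_neq_i r : r != i -> bump j r != i.
Proof. by rewrite /bump; case: leqP => /=; lia. Qed.

Lemma unbump_lt l : (l < n)%N -> l != j -> (unbump j l < n.-1)%N.
Proof. by rewrite /unbump; case: ltnP => /=; lia. Qed.

Lemma unbump_neq_i l : l != i -> l != j -> unbump j l != i.
Proof. by rewrite /unbump; case: ltnP => /=; lia. Qed.

Lemma contractA_nonzero r : (r < n.-1)%N -> nonzero_vec m (a' r).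
Proof.
have [->|ri] := eqVneq r i; last by rewrite contractA_bump // => rn; apply/nz/bump_lt.
move=> _; rewrite contractA_i; have [l [lm al]] := nz lt_in.
by exists l; split=> // el; apply: al; rewrite aiE // el muln0.
Qed.

Definition gcd_var : mpoly k n.-1 := mX k n.-1 i.

Definition phi_var l : mpoly k n.-1 :=
  if l == i then gcd_var ^+ p else if l == j then gcd_var ^+ q else mX k n.-1 (unbump j l).

Definition phi : mpoly k n -> mpoly k n.-1 := meval phi_var (n := n).
HB.instance Definition _ := GRing.RMorphism.copy phi (meval phi_var (n := n)).

Lemma phi_mX l : (l < n)%N -> phi (mX k n l) = phi_var l.
Proof. exact: meval_mX. Qed.

Lemma phi_mX_i : phi (mX k n i) = gcd_var ^+ p.
Proof. by rewrite phi_mX // /phi_var eqxx. Qed.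

Lemma phi_mX_j : phi (mX k n j) = gcd_var ^+ q.
Proof. by rewrite phi_mX // /phi_var eqxx gtn_eqF. Qed.

Lemma phi_mX_bump r : (r < n.-1)%N -> r != i -> phi (mX k n (bump j r)) = mX k n.-1 r.
Proof.
move=> rn ri; rewrite phi_mX ?bump_lt // /phi_var (negPf (bump_neq_i ri)).
by rewrite eq_sym (negPf (neq_bump _ _)) bumpK.
Qed.

Lemma toric_phi f : toric_ideal k n.-1 m a' (phi f) <-> toric_ideal k n m a f.
Proof.
suff E : meval (fun r => tmon k m (a' r)) (phi f) = meval (fun r => tmon k m (a r)) f.
  by rewrite /toric_ideal E.
rewrite /phi meval_comp; apply: eq_meval => l ln; rewrite /phi_var.
have se : meval (fun r => tmon k m (a' r)) gcd_var = tmon k m e.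
  by rewrite meval_mX // contractA_i.
have [->|li] := eqVneq l i.
  by rewrite rmorphXn /= se -tmonMn; apply: eq_tmon => t tm; rewrite aiE.
have [->|lj] := eqVneq l j.
  by rewrite rmorphXn /= se -tmonMn; apply: eq_tmon => t tm; rewrite ajE.
rewrite meval_mX ?unbump_lt // contractA_bump ?unbump_neq_i //.
by rewrite unbumpK // inE.
Qed.

(** Asking for all large [d] lets two summands share a power and two factors split one. *)
Lemma phi_saturated f : exists N, forall d, (N <= d)%N -> exists g, gcd_var ^+ d * f = phi g.
Proof.
have [N0 sgN] := coprime_frobenius p_gt0 q_gt0 pq.
have s_im d : (N0 <= d)%N -> exists g, gcd_var ^+ d = phi g.
  move=> /sgN [u [v ->]]; exists (mX k n i ^+ u * mX k n j ^+ v).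
  rewrite rmorphM !rmorphXn /= phi_mX_i phi_mX_j -!exprM exprD.
  by rewrite (mulnC p) (mulnC q).
elim/mpoly_ind_ring: f => [c|l ln|f g [N Nf] [M Mg]|f g [N Nf] [M Mg]].
- exists N0 => d /s_im [g ->]; exists (g * mC n c).
  by rewrite rmorphM /= [phi (mC n c)]meval_mC.
- have [->|li] := eqVneq l i.
    exists N0 => d dN; have [g gE] := s_im d.+1 (leqW dN).
    by exists g; rewrite -exprSr.
  exists N0 => d /s_im [g ->]; exists (g * mX k n (bump j l)).
  by rewrite rmorphM /= phi_mX_bump.
- exists (N + M)%N => d dN.
  have [f' Ef] := Nf d (leq_trans (leq_addr _ _) dN).
  have [g' Eg] := Mg d (leq_trans (leq_addl _ _) dN).
  by exists (f' + g'); rewrite rmorphD mulrDr Ef Eg.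
- exists (N + M)%N => d dN; have [f' Ef] := Nf N (leqnn N).
  have [|g' Eg] := Mg (d - N)%N; first by lia.
  exists (f' * g'); rewrite rmorphM /= -Ef -Eg mulrACA -exprD subnKC //; lia.
Qed.

(** Setting the gcd variable to zero and renumbering the others realises the quotient as a
    polynomial ring, where [noether_regular_seq] applies. *)
Definition eps_var l : mpoly k n.-2 := if l == i then 0 else mX k n.-2 (unbump i l).
Definition eps : mpoly k n.-1 -> mpoly k n.-2 := meval eps_var (n := n.-1).
HB.instance Definition _ := GRing.RMorphism.copy eps (meval eps_var (n := n.-1)).

Definition sec : mpoly k n.-2 -> mpoly k n.-1 :=
  meval (fun l => mX k n.-1 (bump i l)) (n := n.-2).
HB.instance Definition _ := GRing.RMorphism.copy sec
  (meval (fun l => mX k n.-1 (bump i l)) (n := n.-2)).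

Lemma eps_gcd_var : eps gcd_var = 0.
Proof. by rewrite /eps /gcd_var meval_mX // /eps_var eqxx. Qed.

Lemma bump_i_lt l : (l < n.-2)%N -> (bump i l < n.-1)%N.
Proof. by rewrite /bump; case: leqP => /=; lia. Qed.

Lemma eps_bump l : (l < n.-2)%N -> eps (mX k n.-1 (bump i l)) = mX k n.-2 l.
Proof.
move=> ln; rewrite /eps meval_mX ?bump_i_lt // /eps_var.
by rewrite eq_sym (negPf (neq_bump _ _)) bumpK.
Qed.

Lemma secK : cancel sec eps.
Proof.
move=> f; rewrite /eps /sec meval_comp -[RHS]meval_id; apply: eq_meval => l ln.
exact: eps_bump.
Qed.

Lemma eps_ker f : eps f = 0 <-> exists z, f = gcd_var * z.
Proof.
split=> [f0|[z ->]]; last by rewrite rmorphM /= eps_gcd_var mul0r.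
suff [z zE] : exists z, f = sec (eps f) + gcd_var * z.
  by exists z; rewrite {1}zE f0 rmorph0 add0r.
elim/mpoly_ind_ring: f {f0} => [c|l ln|f g [z fz] [y gy]|f g [z fz] [y gy]].
- by exists 0; rewrite mulr0 addr0 /eps /sec !meval_mC.
- have [->|li] := eqVneq l i; first by exists 1; rewrite mulr1 eps_gcd_var rmorph0 add0r.
  exists 0; rewrite mulr0 addr0.
  have ln' : (unbump i l < n.-2)%N by rewrite /unbump; case: ltnP => /=; lia.
  rewrite /eps meval_mX // /eps_var (negPf li) /sec meval_mX //.
  by rewrite unbumpK // inE.
- exists (z + y); rewrite {1}fz {1}gy !rmorphD /= mulrDr addrACA //.
- exists (z * g + sec (eps f) * y).
  rewrite {1}fz mulrDl {1}gy !rmorphM /= !mulrDr -addrA; congr (_ + _).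
  by rewrite addrC -mulrA [sec _ * _]mulrCA.
Qed.

Definition lift_var l : mpoly k n := mX k n (bump j (bump i l)).

Lemma eps_phi_lift l : (l < n.-2)%N -> eps (phi (lift_var l)) = mX k n.-2 l.
Proof.
move=> ln; rewrite phi_mX_bump ?eps_bump ?bump_i_lt //.
by rewrite eq_sym neq_bump.
Qed.

Lemma rank_contractA : rkA n.-1 m a' = rkA n m a.
Proof.
have le n1 n2 (b c : nat -> nat -> nat) :
    (forall r, (r < n1)%N -> exists2 r', (r' < n2)%N & exists x : rat,
       forall l, (l < m)%N -> (b r l)%:R = x * (c r' l)%:R) ->
    (rkA n1 m b <= rkA n2 m c)%N.
  move=> bc; apply/mxrankS/row_subP => r.
  have [r' rn2 [x xE]] := bc r (ltn_ord r).
  rewrite [X in (X <= _)%MS](_ : _ = x *: row (Ordinal rn2)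
    (\matrix_(i0 < n2, l < m) (c i0 l)%:R)); first exact/scalemx_sub/row_sub.
  by apply/rowP => l; rewrite !mxE xE.
have natr0 d : (0 < d)%N -> (d%:R : rat) != 0 by move=> d0; rewrite Num.Theory.pnatr_eq0 -lt0n.
apply/eqP; rewrite eqn_leq; apply/andP; split; apply: le => r rn.
  have [->|ri] := eqVneq r i.
    exists i => //; exists p%:R^-1 => l lm.
    by rewrite contractA_i aiE // natrM mulKf ?natr0.
  by exists (bump j r); [exact: bump_lt|exists 1 => l _; rewrite mul1r contractA_bump].
have [->|ri] := eqVneq r i.
  by exists i => //; exists p%:R => l lm; rewrite contractA_i aiE // natrM.
have [->|rj] := eqVneq r j.
  by exists i => //; exists q%:R => l lm; rewrite contractA_i ajE // natrM.
exists (unbump j r); first exact: unbump_lt.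
exists 1 => l lm; rewrite mul1r contractA_bump ?unbump_neq_i //.
by rewrite unbumpK // inE.
Qed.

(** Away from [i], the axis kills both images s^p and s^q. Pure powers found in the new generators
    are therefore present in the old ones. *)
Lemma axis_phi r f : (r < n.-1)%N -> r != i -> axis r (phi f) = axis (bump j r) f.
Proof.
move=> rn ri; rewrite /axis /phi meval_comp.
apply: (@eq_meval k 1 (fun l => meval _ (phi_var l))
  (fun l => if l == bump j r then mX k 1 0 else 0) n) => l ln; rewrite /phi_var.
have [->|li] := eqVneq l i.
  rewrite eq_sym (negPf (bump_neq_i ri)) rmorphXn /= meval_mX // eq_sym (negPf ri).
  by rewrite expr0n gtn_eqF.
have [->|lj] := eqVneq l j.
  rewrite (negPf (neq_bump _ _)) rmorphXn /= meval_mX // eq_sym (negPf ri).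
  by rewrite expr0n gtn_eqF.
rewrite meval_mX ?unbump_lt //; congr (if _ then _ else _).
by rewrite -(inj_eq (can_inj (bumpK j))) unbumpK // inE.
Qed.

Lemma in_semigroup_contractA r d : (r < n.-1)%N -> r != i ->
  in_semigroup_except n m a (bump j r) (fun l => d * a (bump j r) l)%N ->
  in_semigroup_except n.-1 m a' r (fun l => d * a' r l)%N.
Proof.
move=> rn ri [c cE].
exists (fun t => if t == i then c i * p + c j * q else c (bump j t))%N => l lm.
rewrite contractA_bump // cE // big_mkcond [RHS]big_mkcond.
rewrite (bigD1_ord (Ordinal jn)) //= neq_bump.
rewrite (bigD1 (Ordinal lt_in1)) //= [RHS](bigD1 (Ordinal lt_in1)) //=.
rewrite eqxx contractA_i (eq_sym i r) ri /=.
have -> : bump j i = i by rewrite /bump leqNgt ij.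
rewrite (eq_sym i) bump_neq_i //= aiE // ajE // addnA; congr (_ + _)%N.
  by rewrite mulnDl !mulnA addnC.
apply: eq_bigr => t; rewrite -val_eqE /= => ti.
by rewrite (negPf ti) contractA_bump // (inj_eq (can_inj (bumpK j))).
Qed.

(** * The images of the remaining generators generate the contracted ideal minimally *)

Section Generators.
Variable G : seq (mpoly k n).
Let g0 : mpoly k n := mX k n i ^+ q - mX k n j ^+ p.
Hypothesis genG : forall f, toric_ideal k n m a f <-> span_ideal (g0 :: G) f.
Hypothesis sizeG : (size G).+1 = (n - rkA n m a)%N.
Let fs := map phi G.
Notation I' := (toric_ideal k n.-1 m a').

Lemma phi_toric g : toric_ideal k n m a g -> span_ideal fs (phi g).
Proof.
move=> /genG /span_ideal_cons [b [f [-> Gf]]].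
have -> : phi (b * g0 + f) = phi f.
  by rewrite rmorphD rmorphM rmorphB !rmorphXn /= phi_mX_i phi_mX_j -!exprM mulnC subrr mulr0 add0r.
exact: (@span_ideal_map _ _ phi).
Qed.

Lemma fs_toric t : (t < size fs)%N -> I' fs`_t.
Proof.
rewrite size_map => ts; rewrite (nth_map 0) //; apply/toric_phi/genG.
exact: (@span_ideal_nth _ (g0 :: G) t.+1).
Qed.

(** The ideal [K] is the image of J at s = 0. Since x_i goes to s^p and then to 0, dependence modulo
    I_A + (x_i) becomes dependence modulo [K]. *)
Lemma regular_seq_in_fs : exists r, [/\ size r = size fs,
  forall t, (t < size r)%N -> span_ideal fs r`_t &
  regular_seq (fun y => exists z, y = gcd_var * z) r].
Proof.
have [J0 JD JM] := span_ideal_is_ideal fs.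
pose K (y : mpoly k n.-2) := exists2 x, span_ideal fs x & eps x = y.
have iK : is_ideal K.
  split=> [|_ _ [x Jx <-] [y Jy <-]|z _ [x Jx <-]].
  - by exists 0; rewrite ?rmorph0.
  - by exists (x + y); rewrite ?rmorphD //; exact: JD.
  - exists (sec z * x); first exact: JM.
    by rewrite rmorphM /= secK.
have Kdep (y : nat -> mpoly k n.-2) :
    exists2 F : mpoly k (rkA n m a), F != 0 & K (meval y F).
  have [F F0 [h Ih]] := @toric_dependent_mod k n m a (fun l => meval lift_var (y l)) i lt_in.
  exists F => //; exists (phi (meval (fun l => meval lift_var (y l)) F + mX k n i * h)).
    exact: phi_toric.
  rewrite !rmorphD !rmorphM /= phi_mX_i rmorphXn /= eps_gcd_var expr0n gtn_eqF // mul0r addr0.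
  rewrite /eps /phi !meval_comp; apply: eq_meval => l _.
  rewrite !meval_comp -[RHS]meval_id; apply: eq_meval => t tn.
  by rewrite -eps_phi_lift // /eps /phi meval_comp.
have [r [sr rK rr]] := noether_regular_seq iK Kdep.
have [r' rE Jr'] : exists2 r', map eps r' = r & forall x, x \in r' -> span_ideal fs x.
  apply: exists_preimage_seq => y yr.
  by rewrite -(nth_index 0 yr); apply: rK; rewrite index_mem.
exists r'; split.
- have -> : size r' = size r by rewrite -rE size_map.
  (* The length is (n - 2) + 1 - rk, exactly one less than the height of I_A. *)
  rewrite sr size_map; have := sizeG; have := jn; have := ij; lia.
- by move=> t tr; apply: Jr'; exact: mem_nth.
- have eps_surj y : exists x, eps x = y by exists (sec y); exact: secK.
  rewrite -rE in rr.
  apply: eq_regular_seq (@regular_seq_lift _ _ eps _ _ eps_surj rr) => y.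
  exact: eps_ker.
Qed.

Lemma contraction_gens f : I' f <-> span_ideal fs f.
Proof.
split; last by apply: span_ideal_min => [|t]; [exact: toric_is_ideal|exact: fs_toric].
move=> If; have [r [sr rJ rr]] := regular_seq_in_fs.
have gcd_var_nzd y : gcd_var * y = 0 -> y = 0.
  case/mpoly_mul_eq0 => // s0.
  have := tmon_neq0 k n.-1 (fun l => (l == i) : nat).
  by rewrite tmon_mX // -/gcd_var s0 eqxx.
have [N /(_ N (leqnn N)) [g sf]] := phi_saturated f.
have : span_ideal fs (gcd_var ^+ N * f).
  rewrite sf; apply: phi_toric; apply/toric_phi; rewrite -sf.
  by have [_ _ IM] := @toric_is_ideal k n.-1 m a'; apply: IM.
elim: N {sf} => [|N IH]; first by rewrite mul1r.
rewrite exprS -mulrA => h; apply: IH.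
by apply: (span_ideal_nzd rr _ rJ gcd_var_nzd h); rewrite sr.
Qed.

(** A combination of [fs] in m I' is rewritten, through [contraction_gens], as a syzygy whose
    coefficients have constant terms [c t]; syzygies have coefficients vanishing at the origin. *)
Lemma contraction_indep : indep_mod I' fs.
Proof.
have [r [sr rJ rr]] := regular_seq_in_fs.
move=> c [h Ih hE].
pose M (f : mpoly k n.-1) := ev0 f = 0.
have iM : is_ideal M.
  rewrite /M; split=> [|x y Mx My|x y My]; first by rewrite rmorph0.
    by rewrite rmorphD /= Mx My addr0.
  by rewrite rmorphM /= My mulr0.
have [H HE] : exists H : 'I_n.-1 -> nat -> mpoly k n.-1,
    forall l : 'I_n.-1, h l = \sum_(t < size fs) H l t * fs`_t.
  apply: (@fin_all_exists 'I_n.-1 (fun=> nat -> mpoly k n.-1)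
    (fun (l : 'I_n.-1) H => h l = \sum_(t < size fs) H t * fs`_t)) => l.
  by have /contraction_gens [H HE] := Ih l; exists H.
pose c' t := mC n.-1 (c t) - \sum_(l < n.-1) mX k n.-1 l * H l t.
have c'0 : \sum_(t < size fs) c' t * fs`_t = 0.
  rewrite /c'; under eq_bigr => t _ do rewrite mulrBl.
  rewrite sumrB hE; apply/eqP; rewrite subr_eq0; apply/eqP.
  under [RHS]eq_bigr => t _ do rewrite mulr_suml.
  rewrite exchange_big; apply: eq_bigr => l _; rewrite HE mulr_sumr.
  by apply: eq_bigr => t _; rewrite mulrA.
move=> t ts; have : M (c' t).
  apply: (syzygy_coef_in (fs := fs) rr _ rJ iM) => //; first by rewrite sr.
  - by rewrite /M ev0_mX.
  - move=> t' ts'; apply: (ev0_toric contractA_nonzero); exact: fs_toric.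
  - by exists 0; rewrite mulr0 c'0.
rewrite /M /c' rmorphB /= ev0_mC rmorph_sum big1 ?subr0 // => l _.
by rewrite rmorphM /= ev0_mX // mul0r.
Qed.

Lemma contraction_CI : toric_CI k n.-1 m a'.
Proof.
have h : toric_height n.-1 m a' = size fs.
  rewrite /toric_height rank_contractA size_map; have := sizeG; lia.
split; first by exists fs; split; [exact: contraction_gens | rewrite h].
move=> gs gsI; rewrite h.
apply: (indep_mod_size (I := I')); first exact: toric_is_ideal.
- exact: fs_toric.
- exact: gsI.
- exact: contraction_indep.
Qed.

(** Semigroup relations for A contract to relations for A', which gives [b <= d]. The opposite bound
    reads a pure power of x_r off one generator. *)
Lemma contraction_mult r b : (r < n.-1)%N -> r != i ->
  is_mult n.-1 m a' r b -> is_mult n m a (bump j r) b.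
Proof.
move=> rn ri [b0 [c cE] bmin].
have sub d : (0 < d)%N ->
    in_semigroup_except n m a (bump j r) (fun l => d * a (bump j r) l)%N -> (b <= d)%N.
  by move=> d0 /in_semigroup_contractA h; apply: bmin => //; exact: h.
suff [d [d0 db semd]] : exists d, [/\ (0 < d)%N, (d <= b)%N &
    in_semigroup_except n m a (bump j r) (fun l => d * a (bump j r) l)%N].
  have bd : b = d by apply/eqP; rewrite eqn_leq db sub.
  by rewrite bd; split=> // d' d'0 /(sub _ d'0); rewrite bd.
(* The coefficient at [r], left free by the semigroup condition, is cleared so that the second
   monomial avoids x_r. *)
pose c0 t := if t == r then 0%N else c t.
pose f := mX k n.-1 r ^+ b - tmon k n.-1 c0.
have If : I' f.
  rewrite /toric_ideal rmorphB rmorphXn /= meval_mX // meval_tmon_tmon -tmonMn.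
  apply/eqP; rewrite subr_eq0; apply/eqP/eq_tmon => l lm.
  rewrite /mdeg cE // big_mkcond; apply: eq_bigr => t _; rewrite /c0.
  by case: eqP.
(* The second monomial vanishes on the axis: otherwise it would be 1, forcing b a'_r = 0. *)
have axf : axis r f = 'X^b.
  rewrite rmorphB rmorphXn /= axis_mX // eqxx axis_tmon //.
  case: forallP => [h|_]; last by rewrite subr0.
  have [l [lm al]] := contractA_nonzero rn; case: al.
  have := cE l lm; rewrite big1; first by nia.
  move=> t tr; have /implyP/(_ tr) := h t.
  by rewrite /c0 (negPf tr) => /eqP ->.
have /contraction_gens [H fE] := If.
have [t [d [ts db fd]]] : exists t d,
    [/\ (t < size fs)%N, (d <= b)%N & (axis r fs`_t)`_d != 0].
  apply: (@coef_sumM_neq0 _ _ (fun t => axis r (H t)) (fun t => axis r fs`_t)).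
  have <- : axis r f = \sum_(t < size fs) axis r (H t) * axis r fs`_t.
    by rewrite fE rmorph_sum; apply: eq_bigr => t _; rewrite rmorphM.
  by rewrite axf coefXn eqxx oner_neq0.
move: ts fd; rewrite size_map => ts; rewrite (nth_map 0) // axis_phi //.
move=> fd; have [|d' [d'0 d'd sem]] := toric_axis nz (bump_lt rn) _ fd.
  by apply/genG; exact: (@span_ideal_nth _ (g0 :: G) t.+1).
by exists d'; split=> //; exact: leq_trans db.
Qed.

End Generators.

End Contraction.

(** * Cones *)

Section RationalCone.
Import Order.TTheory Num.Theory.
Variables (F : realFieldType) (N m : nat) (V : 'M[rat]_(N, m)) (b : 'rV[rat]_m).
Notation toF := (map_mx (ratr : rat -> F)).

(* Among the nonnegative solutions over F, one of minimal support uses linearly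
   independent rows of V, hence is rational. *)
Lemma rational_cone (lam : 'rV[F]_N) :
  (forall t, 0 <= lam 0 t) -> lam *m toF V = toF b ->
  exists2 mu : 'rV[rat]_N, (forall t, 0 <= mu 0 t) & mu *m V = b.
Proof.
move eS: #|[set t | lam 0 t != 0]| => d.
elim/ltn_ind: d lam eS => d IH lam eS lam_ge0 lamV.
pose D : 'M[rat]_N := diag_mx (\row_t (lam 0 t != 0)%:R).
have lamD : lam *m toF D = lam.
  apply/rowP => t; rewrite map_diag_mx mul_mx_diag !mxE rmorph_nat.
  by case: eqP => [->|_]; rewrite ?mul0r ?mulr1.
(* its left kernel consists of the relations among the rows in the support *)
pose B := row_mx (D *m V) (1%:M - D).
(* [lam] satisfies [lam *m B = (b, 0)]; a rational right inverse of [B] then makes [lam] itself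
   rational. *)
have [/row_freeP [W BW]|] := boolP (row_free B).
  have muE : toF (row_mx b 0 *m W) = lam.
    rewrite map_mxM map_row_mx -lamV map_mx0.
    have -> : row_mx (lam *m toF V) 0 = lam *m toF B.
      rewrite map_row_mx mul_mx_row !map_mxM map_mxB map_mx1 mulmxA lamD.
      by rewrite mulmxBr mulmx1 lamD subrr.
    by rewrite -mulmxA -map_mxM BW map_mx1 mulmx1.
  exists (row_mx b 0 *m W).
    by move=> t; have := lam_ge0 t; rewrite -muE mxE ler0q.
  by apply: (map_mx_inj (f := ratr : rat -> F)); rewrite map_mxM muE.
rewrite -kermx_eq0 => /rowV0Pn [mu0 /sub_kermxP mu0B mu0_neq0].
have [mu [i mui] [muV muD]] : exists2 mu : 'rV[rat]_N, exists i, 0 < mu 0 i &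
    mu *m V = 0 /\ mu *m D = mu.
  have /eq_row_mx [mDV mD] : row_mx (mu0 *m (D *m V)) (mu0 *m (1%:M - D)) = row_mx 0 0.
    by rewrite -mul_mx_row mu0B row_mx0.
  have {}mD : mu0 *m D = mu0.
    by apply/esym/eqP; rewrite -subr_eq0 -{1}[mu0]mulmx1 -mulmxBr mD.
  rewrite mulmxA mD in mDV.
  have [i0 [t]] := matrix0Pn _ mu0_neq0; rewrite ord1 neq_lt => /orP [lt|gt].
    exists (- mu0); first by exists t; rewrite mxE oppr_gt0.
    by rewrite !mulNmx mDV mD oppr0.
  by exists mu0; first by exists t.
have musup t : lam 0 t = 0 -> mu 0 t = 0.
  by move=> l0; rewrite -muD mul_mx_diag !mxE l0 eqxx mulr0.
(* Moving along [-mu] until the first coordinate reaches zero keeps the solution nonnegative and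
   shrinks the support. *)
pose r t := lam 0 t / ratr (mu 0 t).
have [i1 mui1 rmin] := @arg_minP _ _ _ i (fun t => 0 < mu 0 t) r mui.
have rmu t : 0 < mu 0 t -> 0 < (ratr (mu 0 t) : F) by rewrite ltr0q.
have r_ge0 : 0 <= r i1 by rewrite divr_ge0 // ltW // rmu.
pose lam' := lam - r i1 *: toF mu.
apply: (IH _ _ lam' erefl).
- rewrite -eS; apply: proper_card; apply/properP; split.
    apply/subsetP => t; rewrite !inE !mxE; apply: contraNneq => l0.
    by rewrite l0 musup // rmorph0 mulr0 subrr.
  exists i1; rewrite !inE.
    by apply: contraTneq mui1 => /musup ->; rewrite ltxx.
  by rewrite !mxE /r divfK ?subrr ?eqxx // gt_eqF // rmu.
- move=> t; rewrite !mxE subr_ge0; have [le|gt] := leP (mu 0 t) 0.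
    by apply: le_trans (lam_ge0 t); rewrite mulr_ge0_le0 // lerq0.
  by rewrite -ler_pdivlMr ?rmu //; exact: rmin.
- by rewrite mulmxBl lamV -scalemxAl -map_mxM muV map_mx0 scaler0 subr0.
Qed.
End RationalCone.

Lemma rsumE f n : rsum f n = \sum_(t < n) f t.
Proof. by elim: n => [|n IH]; rewrite ?big_ord0 // big_ord_recr /= IH. Qed.

Lemma clear_denominators N (mu : 'rV[rat]_N) :
  (forall t, Order.le 0 (mu 0 t)) ->
  exists d (c : nat -> nat), (0 < d)%N /\ forall t : 'I_N, d%:R * mu 0 t = (c t)%:R.
Proof.
move=> mu_ge0; pose dn (t : 'I_N) := `|denq (mu 0%R t)|%N.
have dn0 t : (0 < dn t)%N by rewrite absz_gt0 denq_neq0.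
exists (\prod_t dn t)%N.
exists (fun t => if insub t is Some t' then
  (`|numq (mu 0%R t')| * \prod_(u < N | u != t') dn u)%N else 0%N).
split; first by apply: prodn_gt0.
move=> t; rewrite insubT //= => lt.
have -> : Sub (val t) lt = t by exact: val_inj.
rewrite (bigD1 t) //= !natrM mulrAC; congr (_ * _).
rewrite /dn -[X in _ * X]divq_num_den !natr_absz.
rewrite !Num.Theory.ger0_norm ?numq_ge0 ?denq_ge0 //.
by rewrite mulrC divfK // intr_eq0 denq_neq0.
Qed.

Lemma cone_multiple n m a r : in_cone_except n m a r ->
  exists b, (0 < b)%N /\ in_semigroup_except n m a r (fun l => b * a r l)%N.
Proof.
case=> lam [lam_ge0 lamE].
(* A zero row in place of a_r keeps the indexing by [n] while excluding a_r from the combination. *)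
pose V : 'M[rat]_(n, m) := \matrix_(t, l) if t == r :> nat then 0 else (a t l)%:R.
pose b : 'rV[rat]_m := \row_l (a r l)%:R.
pose lamv : 'rV[Rdefinitions.R]_n := \row_t lam t.
have [||mu mu_ge0 muV] := @rational_cone _ n m V b lamv.
- by move=> t; rewrite mxE; apply/RleP.
- apply/rowP => l; rewrite !mxE rmorph_nat -INRE lamE // rsumE; apply: eq_bigr => t _.
  by rewrite !mxE; case: eqP => _; rewrite ?rmorph0 ?mulr0 // rmorph_nat -INRE.
have [d [c [d0 cE]]] := clear_denominators mu_ge0.
exists d; split=> //; exists c => l lm.
apply/eqP; rewrite -(Num.Theory.eqr_nat rat) natrM.
have -> : (a r l)%:R = b 0 (Ordinal lm) by rewrite mxE.
rewrite -muV mxE mulr_sumr natr_sum [X in _ == X]big_mkcond; apply/eqP/eq_bigr => t _.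
rewrite mulrA cE !mxE; case: eqP => /= _; by rewrite ?mulr0 ?natrM.
Qed.

Lemma is_mult_exists n m a r : in_cone_except n m a r -> exists b, is_mult n m a r b.
Proof.
move=> /cone_multiple [b0 [b0_gt0 sem0]].
elim/ltn_ind: b0 b0_gt0 sem0 => b IH b_gt0 sem.
have [[b' [b'b b'0 sem']]|min] := classic (exists b', [/\ (b' < b)%N, (0 < b')%N &
    in_semigroup_except n m a r (fun l => b' * a r l)%N]).
  exact: IH sem'.
exists b; split=> // b' b'0 sem'; rewrite leqNgt; apply/negP => b'b.
by case: min; exists b'.
Qed.

(** * The proportional pair and its binomial as a minimal generator *)

Section ProportionalPair.
Variables (n m : nat) (a : nat -> nat -> nat) (i j mi mj : nat).
Hypotheses (ij : i != j) (jn : (j < n)%N).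
Hypotheses (multi : is_mult n m a i mi) (multj : is_mult n m a j mj).
Hypothesis mij : forall l, (l < m)%N -> (mi * a i l)%N = (mj * a j l)%N.

(** Dividing [mi a_i = mj a_j] by a common factor would give a smaller multiple of a_i in the
    semigroup of the others. *)
Lemma mult_coprime : coprime mj mi.
Proof.
have [mi0 _ mi_min] := multi; have [mj0 _ _] := multj.
set g := gcdn mj mi.
have g0 : (0 < g)%N by rewrite gcdn_gt0 mj0.
have gi : (g %| mi)%N by exact: dvdn_gcdr.
have gj : (g %| mj)%N by exact: dvdn_gcdl.
have q0 : (0 < mi %/ g)%N by rewrite divn_gt0 // dvdn_leq.
have := mi_min _ q0; rewrite /coprime -/g => h.
have {h} : (mi <= mi %/ g)%N.
  apply: h; exists (fun t => if t == j then mj %/ g else 0)%N => l lm.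
  rewrite (bigD1 (Ordinal jn)) /= ?eqxx; last by rewrite eq_sym.
  rewrite big1 ?addn0 => [|t /andP [_]]; last by rewrite -val_eqE /= => /negPf ->.
  apply/eqP; rewrite -(eqn_pmul2r g0) mulnAC divnK // mulnAC divnK //.
  exact/eqP/mij.
move=> le; rewrite eqn_leq g0 andbT leqNgt; apply: contraL le => g1.
by rewrite -ltnNge ltn_Pdiv.
Qed.

Lemma proportional_gcdv l : (l < m)%N ->
  a i l = (mj * gcdv (a i) (a j) l)%N /\ a j l = (mi * gcdv (a i) (a j) l)%N.
Proof.
move=> lm; have [mi0 _ _] := multi; have [mj0 _ _] := multj.
have /dvdnP [t ait] : (mj %| a i l)%N.
  by rewrite -(Gauss_dvdr _ mult_coprime) mij // dvdn_mulr.
have ajt : a j l = (t * mi)%N.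
  apply/eqP; rewrite -(eqn_pmul2l mj0) -mij // ait; apply/eqP; nia.
rewrite /gcdv ait ajt -muln_gcdr (eqP mult_coprime) muln1.
by rewrite !(mulnC t).
Qed.

End ProportionalPair.

Section BinomialGenerator.
Variables (k : fieldType) (n m : nat) (a : nat -> nat -> nat) (i j p q : nat).
Hypothesis nz : forall r, (r < n)%N -> nonzero_vec m (a r).
Hypotheses (lt_in : (i < n)%N) (jn : (j < n)%N) (ij : i != j).
Hypotheses (p_gt0 : (0 < p)%N) (multi : is_mult n m a i q).
Hypothesis qp : forall l, (l < m)%N -> (q * a i l)%N = (p * a j l)%N.
Let g0 : mpoly k n := mX k n i ^+ q - mX k n j ^+ p.
Notation I := (toric_ideal k n m a).
Let w l := (\sum_(t < m) a l t)%N.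

Let w_gt0 l : (l < n)%N -> (0 < w l)%N.
Proof.
move=> ln; have [t [tm /eqP at0]] := nz ln.
by rewrite /w (bigD1 (Ordinal tm)) //= addn_gt0 lt0n at0.
Qed.

Lemma binomial_toric : I g0.
Proof.
rewrite /toric_ideal rmorphB !rmorphXn /= !meval_mX // -!tmonMn.
by apply/eqP; rewrite subr_eq0; apply/eqP/eq_tmon.
Qed.

Lemma binomial_homog : homog w (w i * q) g0.
Proof.
have wE : (w i * q = w j * p)%N.
  by rewrite /w mulnC (mulnC _ p) !big_distrr; apply: eq_bigr => t _; exact: qp.
rewrite /homog rmorphB !rmorphXn /= !grade_mX // !exprMn -!exprM -wE.
by rewrite !polyCB !rmorphXn mulrBl.
Qed.

(* Minimality of q = m_i: were x_i^q - x_j^p in the maximal ideal times I, x_i^(q-1)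
   would occur in an element of I. *)
Lemma binomial_indep : indep_mod I [:: g0].
Proof.
move=> c [h Ih]; rewrite big_ord_recl big_ord0 addr0 /= => hE [|//] _.
(* On the x_i axis the coefficient of X^q is c_0 on one side, and on the other that of X^(q-1) in
   [h i]. *)
have := congr1 (fun f => (axis i f)`_q) hE.
have [q0 _ qmin] := multi.
rewrite rmorphM rmorphB !rmorphXn /= axis_mC !axis_mX // eqxx eq_sym (negPf ij).
rewrite expr0n gtn_eqF // subr0 coefCM coefXn eqxx mulr1 => ->.
rewrite rmorph_sum (bigD1 (Ordinal lt_in)) //= rmorphM /= axis_mX // eqxx.
rewrite big1 ?addr0 => [|l]; last first.
  by rewrite -val_eqE rmorphM /= axis_mX // => /negPf ->; rewrite mul0r.
rewrite coefXM gtn_eqF //; apply: contraTeq isT => nzc.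
have [b [b0 bq sem]] := toric_axis nz lt_in (Ih i) nzc.
by have := qmin b b0 sem; rewrite leqNgt; move: bq q0; lia.
Qed.

(** The binomial alone is independent modulo m I, so it extends to a homogeneous generating family;
    independence and minimality of the height pin its size from both sides. *)
Lemma toric_CI_binomial : toric_CI k n m a ->
  exists G, (forall f, I f <-> span_ideal (g0 :: G) f) /\
            (size G).+1 = (n - rkA n m a)%N.
Proof.
case=> -[gs [gsI sgs]] gsmin.
have iI : is_ideal I by exact: toric_is_ideal.
have bound G : (forall t, (t < size G)%N -> I G`_t) -> indep_mod I G ->
    (size G <= n - rkA n m a)%N.
  by rewrite -[(n - _)%N]sgs => IG; apply: indep_mod_size.
have [||G [hG indG spG]] := indep_mod_extend (w := w) iI bound (G := [:: g0]).
- by move=> g; rewrite inE => /eqP ->; split;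
    [exact: binomial_toric | exists (w i * q)%N; exact: binomial_homog].
- exact: binomial_indep.
have genG := graded_nakayama w_gt0 iI (fun f d If => toric_hcomp d If) hG spG.
exists G; split=> //; apply/eqP; rewrite eqn_leq; apply/andP; split.
  apply: (bound (g0 :: G)) => // t ts.
  by have [] := hG _ (mem_nth 0 ts).
exact: (gsmin (g0 :: G)).
Qed.

End BinomialGenerator.

Theorem mainTheorem8 (k : fieldType) (n m : nat) (a : nat -> nat -> nat)
  (i j mi mj : nat) :
  (forall r, (r < n)%N -> nonzero_vec m (a r)) ->
  (i < j)%N -> (j < n)%N ->
  toric_CI k n m a ->
  in_cone_except n m a i -> in_cone_except n m a j ->
  is_mult n m a i mi -> is_mult n m a j mj ->
  (forall l, (l < m)%N -> (mi * a i l)%N = (mj * a j l)%N) ->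
  toric_CI k n.-1 m (contractA a i j) /\
  (forall r, (r < n.-1)%N -> in_cone_except n.-1 m (contractA a i j) r ->
     exists b, is_mult n.-1 m (contractA a i j) r b /\
       ((r != i) && (r < j)%N -> is_mult n m a r b) /\
       ((j <= r)%N -> is_mult n m a r.+1 b)).
Proof.
move=> nz ij jn CI _ _ multi multj mij.
have [mi0 _ _] := multi; have [mj0 _ _] := multj.
have lt_in := ltn_trans ij jn; have ij' : i != j by rewrite ltn_eqF.
have cop := mult_coprime ij' jn multi multj mij.
have aE := proportional_gcdv ij' jn multi multj mij.
have aiE l lm := (aE l lm).1; have ajE l lm := (aE l lm).2.
have [G [genG sizeG]] := toric_CI_binomial nz lt_in jn ij' mj0 multi mij CI.
(* The roles cross over: [p] is [mj] and [q] is [mi], since a_i is [mj] times the gcd vector. *)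
split; first exact: (contraction_CI nz ij jn mj0 mi0 cop aiE ajE genG sizeG).
move=> r rn /is_mult_exists [b multb]; exists b; split=> //.
have h ri := contraction_mult nz ij jn mj0 mi0 cop aiE ajE genG sizeG rn ri multb.
split=> [/andP [ri rj]|jr].
  by have := h ri; rewrite /bump leqNgt rj.
by have := h _; rewrite /bump jr; apply; rewrite gtn_eqF // (leq_trans ij).
Qed.
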